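(* If $G$ is a chordal graph, then $\Psi_G(\mathbf x)$ is alternating $e$-positive; that is, for all $d\ge 0$, if $\Psi_G(\mathbf x)|_{\deg d}$ denotes the homogeneous component of degree $d$ of $\Psi_G(\mathbf x)$, then $(-1)^d\,\Psi_G(\mathbf x)|_{\deg d}$ is $e$-positive.
   Context: All graphs are finite and simple. A graph is chordal if it has no induced cycle of length greater than $3$. A symmetric function is $e$-positive if its coefficients in the basis of elementary symmetric functions $\{e_\lambda\}$ are all nonnegative. A weak composition of $m\ge 0$ is an infinite sequence $\nu=(\nu(1),\nu(2),\dots)$ of nonnegative integers with sum $m$; $\mathrm{WComp}_m$ is the set of these. Weak compositions are added and compared ($\nu\ge\mu$) componentwise. An $\infty$-weighted partition of a finite set $S$ is a set $\boldsymbol\pi=\{B_1^{\nu_1},\dots,B_k^{\nu_k}\}$ where $\{B_1,\dots,B_k\}$ is a partition of $S$ and $\nu_i\in\mathrm{WComp}_{|B_i|-1}$ for all $i$. The poset $\Pi_S^\infty$ of all such has order $\{A_1^{\mu_1},\dots,A_j^{\mu_j}\}\le\{B_1^{\nu_1},\dots,B_k^{\nu_k}\}$ iff $\{A_1,\dots,A_j\}$ refines $\{B_1,\dots,B_k\}$ and, whenever $B_m=A_{i_1}\cup\dots\cup A_{i_l}$, one has $\nu_m\ge\mu_{i_1}+\dots+\mu_{i_l}$. For a graph $G=(V,E)$, $\Pi_G^\infty$ is the induced subposet of $\Pi_V^\infty$ of those $\boldsymbol\pi$ each of whose blocks induces a connected subgraph of $G$. Its minimum element $\hat 0$ has all blocks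 singletons of weight $(0,0,\dots)$; all closed intervals are finite. Define the symmetric function, in variables $\mathbf x=(x_1,x_2,\dots)$, $$\Psi_G(\mathbf x)=\sum_{\boldsymbol\pi\in\Pi_G^\infty}\mu_{\Pi_G^\infty}(\hat 0,\boldsymbol\pi)\,\mathbf x^{w(\boldsymbol\pi)},$$ where $w(\boldsymbol\pi)$ is the sum of the weights of the blocks of $\boldsymbol\pi$, $\mathbf x^\nu=x_1^{\nu(1)}x_2^{\nu(2)}\cdots$, and $\mu_P$ is the Möbius function of a poset $P$. *)

(* Defs.v *)
From HB Require Import structures.
From mathcomp Require Import all_boot all_order all_algebra finmap.
From mathcomp Require Import boolp classical_sets functions cardinality fsbigop.
From mathcomp Require Import monalg.

Set Implicit Arguments.
Unset Strict Implicit.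
Unset Printing Implicit Defensive.

Import Order.TTheory GRing.Theory Num.Theory.
Local Open Scope ring_scope.

Section Chordal.
Variables (T : finType) (e : rel T).

(* For a simple graph, such an [s] of size at least 3 lists cyclically the
   vertices of an induced cycle of length [size s]. *)
Definition induced_cycle (s : seq T) : Prop :=
  uniq s /\
  {in s &, forall x y, e x y = (y == next s x) || (x == next s y)}.

Definition chordal : Prop := forall s, induced_cycle s -> (size s <= 3)%N.

Definition connected_in (B : {set T}) : bool :=
  [forall x in B, forall y in B,
     connect [rel u v | [&& u \in B, v \in B & e u v]] x y].

End Chordal.

(* Weak compositions are identified with the monomials x^nu in variables
   indexed by nat (so nu(i) is [nu i.-1]): [mmul] is the componentwise sum,
   [mone] is (0,0,...) and [mdeg nu] is the sum of the entries of nu. *)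
Definition wcomp : Type := {cmonom nat}.
HB.instance Definition _ := Choice.on wcomp.

Definition wcomp_le (mu nu : wcomp) : Prop := forall i, (mu i <= nu i)%N.

Definition wcomp_sum (I : finType) (P : pred I) (F : I -> wcomp) : wcomp :=
  \big[mmul/mone]_(i | P i) F i.

Lemma wcomp_sumE (I : finType) (P : pred I) (F : I -> wcomp) (i : nat) :
  wcomp_sum P F i = (\sum_(j | P j) F j i)%N.
Proof.
apply: (big_morph (fun m : wcomp => m i)) => [x y|]; first exact: cmM.
exact: cm1.
Qed.

Section WeightedPartitions.
Variable T : finType.

(* The weight function is required to be trivial off the blocks, so that equal
   weighted partitions are equal as terms. *)
Definition is_wpart (p : {set {set T}} * {ffun {set T} -> wcomp}) : bool :=
  [&& finset.partition p.1 [set: T],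
      [forall B in p.1, mdeg (p.2 B) == #|B|.-1]
    & [forall B, (B \notin p.1) ==> (p.2 B == mone)]].

Record wpart : Type := WPart {
  wpart_val :> {set {set T}} * {ffun {set T} -> wcomp};
  wpartP : is_wpart wpart_val }.

HB.instance Definition _ := [isSub for wpart_val].
HB.instance Definition _ := [Choice of wpart by <:].

Definition blocks (p : wpart) : {set {set T}} := p.1.
Definition wt (p : wpart) (B : {set T}) : wcomp := p.2 B.
Definition weight (p : wpart) : wcomp := wcomp_sum (mem (blocks p)) (wt p).

Definition wpart_le (p q : wpart) : bool :=
  `[< (forall A, A \in blocks p -> exists2 B, B \in blocks q & A \subset B) /\
      (forall B, B \in blocks q ->
         wcomp_le
           (wcomp_sum (fun A => (A \in blocks p) && (A \subset B)) (wt p))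
           (wt q B)) >].

Lemma blocks_partition p : finset.partition (blocks p) [set: T].
Proof. by case/and3P: (wpartP p). Qed.

Lemma wt_out p B : B \notin blocks p -> wt p B = mone.
Proof.
case/and3P: (wpartP p) => _ _ /forallP/(_ B)/implyP h Bp; exact/eqP/h.
Qed.

Lemma blocks_meet p A B x : A \in blocks p -> B \in blocks p ->
  x \in A -> x \in B -> A = B.
Proof.
case/and3P: (blocks_partition p) => _ tI _ Ap Bp xA xB.
by rewrite -(def_pblock tI Ap xA) -(def_pblock tI Bp xB).
Qed.

Lemma block_ex p A : A \in blocks p -> exists x, x \in A.
Proof.
case/and3P: (blocks_partition p) => _ _ n0 Ap.
by apply/set0Pn; apply: contraNneq n0 => <-.
Qed.

Lemma wpart_eq p q : blocks p = blocks q ->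
  (forall B, B \in blocks p -> forall i, wt p B i = wt q B i) -> p = q.
Proof.
move=> bE wE; apply/val_inj.
case: p q bE wE => [[P w] hp] [[Q v] hq]; rewrite /blocks /wt /= => bE wE.
move: hp hq wE; rewrite -bE => hp hq wE; congr pair; apply/ffunP => B.
case: (boolP (B \in P)) => [BP|nBP]; first by apply/eqP/cmP; exact: wE.
by have := @wt_out (WPart hp) B nBP; have := @wt_out (WPart hq) B nBP;
  rewrite /wt /= => -> ->.
Qed.

Lemma wpart_lexx : reflexive wpart_le.
Proof.
move=> p; apply/asboolP; split=> [A Ap|B Bp i]; first by exists A.
rewrite wcomp_sumE (big_pred1 B) // => A /=.
apply/andP/eqP => [[Ap AB]|->]; last by [].
have [x xA] := block_ex Ap.
by apply: (blocks_meet Ap Bp xA); apply: (fintype.subsetP AB).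
Qed.

Lemma wpart_le_blocks p q : wpart_le p q -> wpart_le q p ->
  {subset blocks p <= blocks q}.
Proof.
move=> /asboolP[pq _] /asboolP[qp _] A Ap.
have [B Bq AB] := pq _ Ap; have [C Cp BC] := qp _ Bq.
have [x xA] := block_ex Ap.
have AC : A = C.
  apply: (blocks_meet Ap Cp xA).
  by apply/(fintype.subsetP BC)/(fintype.subsetP AB).
suff -> : A = B by [].
by apply/eqP; rewrite finset.eqEsubset AB AC.
Qed.

Lemma wpart_le_wt p q B i : wpart_le p q -> B \in blocks p -> B \in blocks q ->
  (wt p B i <= wt q B i)%N.
Proof.
move=> /asboolP[_ h] Bp Bq; apply: leq_trans (h _ Bq i).
by rewrite wcomp_sumE (bigD1 B) /= ?Bp ?subxx // leq_addr.
Qed.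

Lemma wpart_le_anti : antisymmetric wpart_le.
Proof.
move=> p q /andP[pq qp].
have bE : blocks p = blocks q.
  by apply/setP => B; apply/idP/idP; apply: wpart_le_blocks.
apply: wpart_eq => // B Bp i; apply/eqP.
by rewrite eqn_leq !wpart_le_wt // -?bE.
Qed.

Lemma wpart_le_trans : transitive wpart_le.
Proof.
move=> q p r /asboolP[pq wpq] /asboolP[qr wqr]; apply/asboolP; split.
  move=> A /pq[B /qr[C Cr BC] AB]; exists C => //.
  exact: fintype.subset_trans AB BC.
move=> C Cr i; apply: leq_trans (wqr _ Cr i); rewrite !wcomp_sumE.
pose F (A : {set T}) := (\sum_(B : {set T} |
  [&& B \in blocks q, B \subset C & A \subset B]) wt p A i)%N.
apply: (@leq_trans (\sum_(A : {set T} |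
    (A \in blocks p) && (A \subset C)) F A)%N).
  apply: leq_sum => A /andP[Ap AC]; have [B Bq AB] := pq _ Ap.
  have [C' C'r BC'] := qr _ Bq; have [x xA] := block_ex Ap.
  have CC : C' = C.
    apply: (blocks_meet C'r Cr (x := x)); last exact: (fintype.subsetP AC).
    by apply/(fintype.subsetP BC')/(fintype.subsetP AB).
  rewrite /F (bigD1 B) /=; first exact: leq_addr.
  by rewrite Bq AB -CC BC'.
rewrite (exchange_big_dep (fun B : {set T} =>
  (B \in blocks q) && (B \subset C))) /=;
  last by move=> A B _ /and3P[-> ->].
apply: leq_sum => B /andP[Bq BC]; apply: leq_trans (wpq _ Bq i).
rewrite wcomp_sumE big_mkcond [leqRHS]big_mkcond leq_sum // => A _.
rewrite Bq BC /=.
by case: (A \in blocks p); case: (A \subset B); case: (_ \subset _).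
Qed.

HB.instance Definition _ := Order.Le_isPOrder.Build (Order.Disp tt tt) wpart
  wpart_lexx wpart_le_anti wpart_le_trans.

End WeightedPartitions.

(* The poset Pi_G^oo, with the order induced from Pi_V^oo. *)
Section WeightedBonds.
Variables (T : finType) (e : rel T).

Record wbond : Type := WBond {
  wbond_val :> wpart T;
  wbondP : [forall B in blocks wbond_val, connected_in e B] }.

HB.instance Definition _ := [isSub for wbond_val].
HB.instance Definition _ := [Choice of wbond by <:].
HB.instance Definition _ :=
  [SubChoice_isSubPOrder of wbond by <: with Order.Disp tt tt].

Definition singletons : {set {set T}} := [set [set x] | x in [set: T]]%SET.

Lemma wpart0_subproof : is_wpart (singletons, [ffun=> mone : wcomp]).
Proof.
apply/and3P; split => /=.
- apply/and3P; split.
  + apply/eqP/setP => x; rewrite inE; apply/finset.bigcupP.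
    by exists [set x]%SET; rewrite ?inE //; apply/imsetP; exists x.
  + apply/finset.trivIsetP => _ _ /imsetP[x _ ->] /imsetP[y _ ->] nxy.
    rewrite disjoints1 inE; by apply: contraNneq nxy => ->.
  + by apply/imsetP => -[x _ /setP/(_ x)]; rewrite !inE eqxx.
- apply/forallP => B; apply/implyP => /imsetP[x _ ->].
  by rewrite ffunE mdeg1 cards1.
- by apply/forallP => B; rewrite ffunE eqxx implybT.
Qed.

Lemma wbond0_subproof :
  [forall B in blocks (WPart wpart0_subproof), connected_in e B].
Proof.
apply/forallP => B; apply/implyP => /imsetP[x _ ->].
apply/forallP => y; apply/implyP; rewrite inE => /eqP->.
by apply/forallP => z; apply/implyP; rewrite inE => /eqP->.
Qed.

Definition wbond0 : wbond := WBond wbond0_subproof.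

Lemma wbond0_le (p : wbond) : (wbond0 <= p)%O.
Proof.
apply/asboolP; split=> [_ /imsetP[x _ ->]|B _ i].
  have := blocks_partition p => /and3P[/eqP cv _ _].
  have : x \in finset.cover (blocks p) by rewrite cv inE.
  by case/finset.bigcupP => B Bp xB; exists B; rewrite // finset.sub1set.
by rewrite wcomp_sumE big1 // => A _; rewrite /wt /= ffunE cm1.
Qed.

End WeightedBonds.

Local Open Scope classical_set_scope.

(* A sum over a set is 0 by convention when infinitely many terms are
   nonzero; the [finite_*] lemmas show that this never happens below. *)
Section Finiteness.

Lemma finite_inj_fin (U : Type) (F : finType) (A : set U) (f : U -> F) :
  {in A &, injective f} -> finite_set A.
Proof.
move=> fI; rewrite -(eq_finite_set (inj_card_eq fI)); exact: finite_finset.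
Qed.

Definition wcomp_code (nu : wcomp) (n : nat) : {ffun 'I_n -> 'I_n} :=
  [ffun i : 'I_n => insubd i (nu i)].

Lemma wcomp_bound (nu : wcomp) :
  exists n, forall mu, wcomp_le mu nu -> forall i,
    ((mu i < n) /\ ((n <= i) -> mu i = 0))%N.
Proof.
exists (\max_(i <- finsupp nu) i + mdeg nu).+1%N => mu le i; split.
  rewrite ltnS (leq_trans (le i)) // (leq_trans _ (leq_addl _ _)) //.
  case: (boolP (i \in finsupp nu)) => h; last by rewrite fsfun_dflt.
  by rewrite mdegE (big_fsetD1 i) //= leq_addr.
move=> ni; apply/eqP; rewrite -leqn0 (leq_trans (le i)) // leqn0.
rewrite cmE_eq0; apply/negP => h; move: ni; rewrite leqNgt => /negP; apply.
by rewrite ltnS (leq_trans _ (leq_addr _ _)) // (big_fsetD1 i) //= leq_maxl.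
Qed.

Lemma wcomp_code_inj n (mu nu : wcomp) :
  (forall i, ((mu i < n) /\ ((n <= i) -> mu i = 0))%N) ->
  (forall i, ((nu i < n) /\ ((n <= i) -> nu i = 0))%N) ->
  wcomp_code mu n = wcomp_code nu n -> mu = nu.
Proof.
move=> hm hn /ffunP E; apply/eqP/cmP => i; case: (ltnP i n) => [lt_in|].
  have := congr1 val (E (Ordinal lt_in)); rewrite !ffunE /insubd !val_insubd.
  by rewrite (hm i).1 (hn i).1.
by move=> le_ni; rewrite (hm i).2 // (hn i).2.
Qed.

Lemma finite_wpart_le (T : finType) (nu : wcomp) :
  finite_set [set p : wpart T | wcomp_le (weight p) nu].
Proof.
have [n hn] := wcomp_bound nu.
have hp (p : wpart T) B i : wcomp_le (weight p) nu ->
    ((wt p B i < n) /\ ((n <= i) -> wt p B i = 0))%N.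
  move=> pnu; apply: hn => j; apply: leq_trans (pnu j).
  rewrite wcomp_sumE; case: (boolP (B \in blocks p)) => Bp.
    by rewrite (bigD1 B) //= leq_addr.
  by rewrite wt_out // cm1.
pose f (p : wpart T) : {set {set T}} * {ffun {set T} -> {ffun 'I_n -> 'I_n}} :=
  (blocks p, [ffun B => wcomp_code (wt p B) n]).
apply: (@finite_inj_fin _ _ _ f) => p q.
rewrite !inE /= => pn qn [bE /ffunP wE].
apply: wpart_eq => // B _ i; have := wE B; rewrite !ffunE.
by move=> /wcomp_code_inj -> // j; apply: hp.
Qed.

Variables (T : finType) (e : rel T).

Lemma finite_wbond_le nu :
  finite_set [set p : wbond e | wcomp_le (weight p) nu].
Proof.
by apply: finite_preimage (finite_wpart_le T nu) => p q _ _; exact: val_inj.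
Qed.

Lemma finite_wbond_weight nu : finite_set [set p : wbond e | weight p = nu].
Proof. by apply: sub_finite_set (finite_wbond_le nu) => p /= -> i. Qed.

Lemma weight_le (p q : wpart T) : (p <= q)%O -> wcomp_le (weight p) (weight q).
Proof.
move=> /asboolP[pq wpq] i; rewrite !wcomp_sumE.
pose F (A : {set T}) := (\sum_(B in blocks q | A \subset B) wt p A i)%N.
apply: (@leq_trans (\sum_(A in blocks p) F A)%N).
  apply: leq_sum => A Ap; have [B Bq AB] := pq _ Ap.
  by rewrite /F (bigD1 B) ?Bq //= leq_addr.
rewrite (exchange_big_dep (mem (blocks q))) /=; last by move=> A B _ /andP[].
apply: leq_sum => B Bq; apply: leq_trans (wpq _ Bq i).
have {}Bq : B \in blocks q := Bq.
by rewrite wcomp_sumE leq_eqVlt; under eq_bigl do rewrite Bq /=; rewrite eqxx.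
Qed.

Lemma finite_wcomp_mul (nu : wcomp) :
  finite_set [set p : wcomp * wcomp | mmul p.1 p.2 = nu].
Proof.
have [n hn] := wcomp_bound nu.
apply: (@finite_inj_fin _ _ _
  (fun p : wcomp * wcomp => (wcomp_code p.1 n, wcomp_code p.2 n))).
have hl (p : wcomp * wcomp) : mmul p.1 p.2 = nu -> wcomp_le p.1 nu.
  by move=> <- i; rewrite cmM leq_addr.
have hr (p : wcomp * wcomp) : mmul p.1 p.2 = nu -> wcomp_le p.2 nu.
  by move=> <- i; rewrite cmM leq_addl.
move=> p q; rewrite !inE /= => pn qn [p1 p2].
rewrite [p]surjective_pairing [q]surjective_pairing; congr pair.
  by apply: wcomp_code_inj p1; apply: hn; apply: hl.
by apply: wcomp_code_inj p2; apply: hn; apply: hr.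
Qed.

End Finiteness.

Section Mobius.
Variables (d : Order.disp_t) (P : porderType d).

Definition poset_itv (x y : P) : set P := [set z | (x <= z <= y)%O].

Definition locally_finite : Prop := forall x y, finite_set (poset_itv x y).

(* mu(x, x) = 1, and mu(x, y) = - sum_(x <= z < y) mu(x, z) if x != y; the
   argument [n] only ensures termination.  If x is not below y the sum is
   empty, so that the value is 0. *)
Fixpoint mobius_rec (n : nat) (x y : P) : int :=
  if x == y then 1 else
  if n is m.+1
  then - \sum_(z \in [set z | (x <= z < y)%O]) mobius_rec m x z
  else 0.

Definition mobius (x y : P) : int :=
  mobius_rec #|` fset_set (poset_itv x y)| x y.

Hypothesis P_lf : locally_finite.

Lemma card_itv_lt x y z : (x <= z < y)%O ->
  (#|` fset_set (poset_itv x z)| < #|` fset_set (poset_itv x y)|)%N.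
Proof.
move=> /andP[xz zy]; apply: fproper_ltn_card; apply/andP; split.
  apply/fsubsetP => u; rewrite !in_fset_set // !inE /poset_itv /=.
  by case/andP=> -> uz; exact: le_trans uz (ltW zy).
apply/negP => /fsubsetP/(_ y); rewrite !in_fset_set // !inE /poset_itv /= lexx.
rewrite (le_trans xz (ltW zy)) => /(_ isT) /andP[_ yz].
by have := lt_le_trans zy yz; rewrite ltxx.
Qed.

Lemma mobius_rec_stable n m x y :
  (#|` fset_set (poset_itv x y)| <= n)%N ->
  (#|` fset_set (poset_itv x y)| <= m)%N -> mobius_rec n x y = mobius_rec m x y.
Proof.
have empty z : #|` fset_set (poset_itv x z)| = 0%N -> ~~ (x <= z)%O.
  move/cardfs0_eq => h; apply/negP => xz.
  suff : x \in fset_set (poset_itv x z) by rewrite h inE.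
  by rewrite in_fset_set // inE /poset_itv /= lexx.
have out k z : ~~ (x <= z)%O -> mobius_rec k x z = 0.
  move=> nxz; have nE : (x == z) = false.
    by apply/negP => /eqP xz; rewrite xz lexx in nxz.
  case: k => [|k] /=; rewrite nE // fsbig1 ?oppr0 // => u /= /andP[xu uz].
  by rewrite (le_trans xu (ltW uz)) in nxz.
elim: n m y => [|n IHn] [|m] y // hn hm.
- by move: hn; rewrite leqn0 => /eqP/empty/out h; rewrite !h.
- by move: hm; rewrite leqn0 => /eqP/empty/out h; rewrite !h.
move=> /=; case: eqP => // _; congr (- _); apply: eq_fsbigr => z.
rewrite inE /= => xzy; have h := card_itv_lt xzy.
by apply: IHn; rewrite -ltnS; apply: leq_trans h _.
Qed.

Lemma mobiusxx x : mobius x x = 1.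
Proof. by rewrite /mobius; case: #|` _| => [|n] /=; rewrite eqxx. Qed.

Lemma mobius_sum x y : (x < y)%O ->
  \sum_(z \in poset_itv x y) mobius x z = 0.
Proof.
move=> xy; rewrite (fsbigD1 y) //=; last by rewrite /poset_itv /= (ltW xy) lexx.
apply/eqP; rewrite addr_eq0 {1}/mobius; apply/eqP.
rewrite (@mobius_rec_stable _ #|` fset_set (poset_itv x y)|.+1) //= (lt_eqF xy).
congr (- _); rewrite (_ : _ `\ y = [set z | (x <= z < y)%O]); last first.
  apply/seteqP; split => z /=; rewrite /poset_itv /=.
    by case=> /andP[-> zy] /eqP nzy; rewrite lt_neqAle nzy zy.
  case/andP => xz zy; rewrite xz (ltW zy); split=> //.
  by apply/eqP; rewrite lt_eqF.
apply: eq_fsbigr => z; rewrite inE /= => xzy; apply: mobius_rec_stable => //.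
exact: ltnW (card_itv_lt xzy).
Qed.

End Mobius.

Lemma finite_wbond_itv (T : finType) (e : rel T) :
  @locally_finite _ (wbond e).
Proof.
move=> p q; apply: sub_finite_set (finite_wbond_le e (weight q)).
by move=> r /= /andP[_ rq]; exact: weight_le.
Qed.

(* Formal power series in x_1, x_2, ... with integer coefficients: [f nu] is
   the coefficient of x^nu. *)
Definition series : Type := wcomp -> int.

Definition series_one : series := fun nu => (nu == mone)%:R.

Definition series_mul (f g : series) : series := fun nu =>
  \sum_(p \in [set p : wcomp * wcomp | mmul p.1 p.2 = nu]) (f p.1 * g p.2).

Definition homog (d : nat) (f : series) : series :=
  fun nu => if mdeg nu == d then f nu else 0.

Definition elem_sym (k : nat) : series := fun nu =>
  ((mdeg nu == k) && all (fun i => nu i <= 1)%N (finsupp nu))%:R.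

Definition is_part (s : seq nat) : bool := sorted geq s && (0%N \notin s).
Definition intpart : Type := {s : seq nat | is_part s}.
HB.instance Definition _ := Choice.on intpart.

Definition elem_sym_part (lam : intpart) : series :=
  \big[series_mul/series_one]_(k <- val lam) elem_sym k.

Definition e_positive (f : series) : Prop :=
  exists c : {fsfun intpart -> int with 0},
    (forall nu, f nu = \sum_(lam <- finsupp c) c lam * elem_sym_part lam nu) /\
    (forall lam, 0 <= c lam).

Definition Psi (T : finType) (e : rel T) : series := fun nu =>
  \sum_(p \in [set p : wbond e | weight p = nu]) mobius (wbond0 e) p.

(* Main.v *)
(** Let phi_C = (-1)^(|C|-1) psi_C, where psi_C is the sum of mu(0, {C^nu}) x^nu
over nu in WComp_(|C|-1) if C is connected, and 0 otherwise.  Lower intervals of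
the weighted bond poset are products over blocks, so Psi_G is the sum, over the
partitions P of V into connected blocks, of the product of the psi_B, and it
suffices that phi_C is e-positive.  The defining recursion of the Moebius
function reads, for connected C with at least two vertices,
  sum_{P |- C} (-1)^(|P|-1) h_(|P|-1) prod_{B in P} phi_B = 0.        (1)
Order the vertices by a perfect elimination order and let v be the least vertex
of C.  Then (1) is solved by
  phi_C = sum_{P |- C \ v} (prod_{B in P} phi_B) sum_t e_runs(t),      (2)
where t ranges over the orderings of P all of whose prefixes induce, together
with v, a connected subgraph, and e_runs(t) is the product of the e_k over the
lengths k of the maximal runs of t that increase with respect to the least
vertices of the blocks.  Indeed, substituting (2) for the block of v in (1), one
has to show, for every P |- C \ v, that the sum of
(-1)^(|P|-|S|) h_(|P|-|S|) e_runs(s) over S <= P and over the admissible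
orderings s of S is 0.  Appending P \ S in increasing order to s keeps it
admissible, because in a connected subgraph every vertex but the least one has a
smaller neighbor; the sum over the possible cuts of the last run of the resulting
ordering is then sum_i (-1)^i h_i e_(l-i) = 0. *)

From HB Require Import structures.
Require Import Defs.
From mathcomp Require Import all_boot.

Set Implicit Arguments.
Unset Strict Implicit.
Unset Printing Implicit Defensive.

(** * Perfect elimination orders of chordal graphs *)

Section Elimination.
Variables (T : finType) (e : rel T).
Hypotheses (e_sym : symmetric e) (e_irr : irreflexive e) (e_chordal : chordal e).

Definition restr_rel (B : {set T}) : rel T := [rel u v | [&& u \in B, v \in B & e u v]].

Lemma restr_rel_sub (A B : {set T}) : A \subset B -> subrel (restr_rel A) (restr_rel B).
Proof. by move=> /subsetP s x y /and3P[/s xA /s yA exy]; apply/and3P. Qed.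

Lemma connect_restr_sub (A B : {set T}) x y : A \subset B ->
  connect (restr_rel A) x y -> connect (restr_rel B) x y.
Proof.
by move=> s; apply: connect_sub => a b /(restr_rel_sub s) h; apply: connect1.
Qed.

Lemma connect_restr_mem (A : {set T}) x y :
  x \in A -> connect (restr_rel A) x y -> y \in A.
Proof.
move=> xA /connectP[p]; elim: p x xA => [|a p IH] x xA /=; first by move=> _ ->.
by case/andP=> /and3P[_ aA _]; apply: IH.
Qed.

Lemma restr_rel_sym (B : {set T}) : symmetric (restr_rel B).
Proof. by move=> x y; rewrite /restr_rel /= e_sym andbCA. Qed.

Lemma connect_restr_sym (B : {set T}) : connect_sym (restr_rel B).
Proof. exact/sym_connect_sym/restr_rel_sym. Qed.

(** Every vertex of a path from [w] is reachable from [w], so the path stays inside the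
    component. *)
Lemma connect_component (W : {set T}) w c : connect (restr_rel W) w c ->
  connect (restr_rel [set u | connect (restr_rel W) w u]) w c.
Proof.
case/connectP => p; elim/last_ind: p c => [|p a IH] c; first by move=> _ ->.
rewrite rcons_path last_rcons => /andP[pp ra] ->.
apply: connect_trans (IH _ pp erefl) (connect1 _).
have cw : connect (restr_rel W) w (last w p) by apply/connectP; exists p.
case/and3P: (ra) => _ _ ea; apply/and3P; split; rewrite ?inE //.
exact: connect_trans cw (connect1 ra).
Qed.

Lemma connected_inP (B : {set T}) :
  reflect {in B &, forall x y, connect (restr_rel B) x y} (connected_in e B).
Proof.
apply: (iffP idP) => [/forall_inP h x y xB yB|h].
  by have /forall_inP := h x xB; apply.
by apply/forall_inP => x xB; apply/forall_inP => y yB; apply: h.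
Qed.

Lemma shortest_path (r : rel T) x y : connect r x y ->
  exists p, [/\ path r x p, y = last x p, uniq (x :: p) &
    forall p', path r x p' -> y = last x p' -> size p <= size p'].
Proof.
move=> /connectP[p0 pp0 l0].
pose P n := [exists p : n.-tuple T, path r x p && (y == last x p)].
have exP : exists n, P n.
  by exists (size p0); apply/existsP; exists (in_tuple p0); rewrite pp0 l0 eqxx.
case: (ex_minnP exP) => n /existsP[p /andP[pp /eqP lp]] nmin.
have pmin p' : path r x p' -> y = last x p' -> size p <= size p'.
  move=> pp' lp'; rewrite size_tuple; apply: nmin; apply/existsP.
  by exists (in_tuple p'); rewrite pp' lp' eqxx.
(* Removing repetitions cannot lengthen the path, so the result is still shortest. *)
move: lp pmin; case/shortenP: pp => p' pp' up' sub' lp pmin.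
exists p'; split => // p'' pp'' lp''; apply: leq_trans (pmin p'' pp'' lp'').
by apply: uniq_leq_size => //; case/andP: up'.
Qed.

(** A chord would allow the path to skip the vertices strictly between its ends. *)
Lemma shortest_path_chordless (r : rel T) x p v i j :
  path r x p ->
  (forall p', path r x p' -> last x p = last x p' -> size p <= size p') ->
  i.+1 < j -> j <= size p -> ~~ r (nth v (x :: p) i) (nth v (x :: p) j).
Proof.
move=> pp pmin; case: j => // j ij jp; apply/negP => rij.
have ip : i <= size p by rewrite ltnW // (leq_trans _ jp) // ltnW.
have lti : last x (take i p) = nth v (x :: p) i.
  by rewrite (last_nth v) size_takel //; case: i ij ip {rij} => //= i ij ip; rewrite nth_take.
have := pmin (take i p ++ drop j p).
rewrite cat_path last_cat take_path // (drop_nth v) //= lti rij /=.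
have -> : path r (nth v p j) (drop j.+1 p).
  by move: pp; rewrite -{1}(cat_take_drop j.+1 p) cat_path (take_nth v) // last_rcons => /andP[].
have -> : last x p = last (nth v p j) (drop j.+1 p).
  by rewrite -{1}(cat_take_drop j.+1 p) last_cat (take_nth v) // last_rcons.
move=> /(_ isT erefl); rewrite size_cat /= size_takel // size_drop leqNgt => /negP; apply.
by rewrite subnSK // addnC -ltn_subRL subKn // ltnW.
Qed.

(** If [x] and [y] were not adjacent, a shortest path between them through [C], closed up by [v],
    would be an induced cycle of length at least 4. *)
Lemma chordal_separator (v x y : T) (C : {set T}) :
  e v x -> e v y -> x != y -> {in C, forall c, (c != v) && ~~ e v c} ->
  connect (restr_rel (x |: (y |: C))) x y -> e x y.
Proof.
move=> evx evy nxy vC cxy; apply/negPn/negP => nexy.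
have [p [pp lp up pmin]] := shortest_path cxy.
set B := (x |: _) in pp pmin cxy.
rewrite lp in pmin; set n := size p.
have qB k : k <= n -> nth v (x :: p) k \in B.
  case: k => [_|k kn] /=; first by rewrite !inE eqxx.
  by have /(pathP v)/(_ k kn)/and3P[] := pp.
have qn : nth v (x :: p) n = y by rewrite lp (last_nth v).
have n2 : 2 <= n.
  rewrite /n; case: (p) pp lp => [|a [|b q]] //=; first by move=> _ h; rewrite h eqxx in nxy.
  by move=> /andP[/and3P[_ _ h] _] h'; rewrite h' h in nexy.
have qC k : 0 < k < n -> nth v (x :: p) k \in C.
  case/andP=> k0 kn; have := qB k (ltnW kn); rewrite !inE -qn.
  have -> : (nth v (x :: p) k == x) = false.
    by rewrite -[X in _ == X]/(nth v (x :: p) 0) nth_uniq //= ?ltnS ?(ltnW kn) //; case: (k) k0.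
  by rewrite nth_uniq //= ?ltnS ?(ltnW kn) // (ltn_eqF kn).
have qe i j : i < j -> j <= n -> e (nth v (x :: p) i) (nth v (x :: p) j) = (j == i.+1).
  move=> ij jn; have [->|nij] := eqVneq j i.+1.
    by have /(pathP v)/(_ i)/(_ (leq_trans ij jn))/and3P[] := pp.
  have ij2 : i.+1 < j by rewrite ltn_neqAle eq_sym nij.
  apply/negbTE; have := shortest_path_chordless v pp pmin ij2 jn; apply: contra => h.
  by apply/and3P; split => //; apply: qB => //; apply: leq_trans jn; apply: ltnW.
have vq k : k <= n -> e v (nth v (x :: p) k) = (k == 0) || (k == n).
  move=> kn; have [->|k0] := eqVneq k 0; first by rewrite evx.
  have [->|kn'] := eqVneq k n; first by rewrite qn evy.
  have /vC/andP[_ /negbTE//] : nth v (x :: p) k \in C.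
  by apply: qC; rewrite lt0n k0 ltn_neqAle kn' kn.
pose s := v :: x :: p.
have us : uniq s.
  rewrite cons_uniq up andbT; apply/negP => /(nthP v)[k]; rewrite ltnS => kn h.
  have := vq k kn; rewrite h e_irr => /esym/negbT; rewrite negb_or => /andP[k0 k1].
  have /vC : nth v (x :: p) k \in C by apply: qC; rewrite lt0n k0 ltn_neqAle k1.
  by rewrite h eqxx.
have se i j : i < j -> j <= n.+1 ->
    e (nth v s i) (nth v s j) = (j == i.+1) || (i == 0) && (j == n.+1).
  case: i => [|i]; case: j => // j; rewrite ltnS => ij jn; first by rewrite /= vq // eqSS.
  by rewrite /= orbF qe.
have nexts i : i <= n.+1 -> next s (nth v s i) = nth v s (if i == n.+1 then 0 else i.+1).
  move=> ilen; rewrite next_nth mem_nth // index_uniq //=; case: eqP => [->|_] //.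
  by rewrite /= nth_default.
suff /e_chordal : induced_cycle e s by rewrite /= !ltnS leqNgt n2.
split=> // a b /(nthP v)[i ilen <-] /(nthP v)[j jlen <-].
have ltif k : k < size s -> (if k == n.+1 then 0 else k.+1) < size s.
  by case: ifPn => // nk; rewrite ltnS leq_eqVlt (negbTE nk).
rewrite !nexts ?nth_uniq ?ltif //.
wlog ij : i j ilen jlen / i <= j.
  move=> wl; case: (leqP i j) => [|/ltnW] ij; first exact: wl.
  by rewrite e_sym orbC wl.
move: ij; rewrite leq_eqVlt => /orP[/eqP<-|ij].
  rewrite e_irr orbb; case: (eqVneq i n.+1) => [->|_] //.
  by rewrite (ltn_eqF (ltnSn i)).
rewrite se // (ltn_eqF (leq_trans ij jlen)).
case: (eqVneq j n.+1) => [->|nj]; first by rewrite andbT.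
by rewrite andbF (ltn_eqF (leqW ij)).
Qed.

Definition simplicial (U : {set T}) (z : T) : Prop :=
  {in U &, forall a b, e z a -> e z b -> a != b -> e a b}.

(** Dirac's theorem on simplicial vertices in a form suited to induction: the simplicial vertex is
    found among the non-neighbors of any [v] that has one. *)
Definition has_far_simplicial (U : {set T}) : Prop :=
  forall v u, v \in U -> u \in U -> u != v -> ~~ e v u ->
  exists z, [/\ z \in U, z != v, ~~ e v z & simplicial U z].

(** Either two vertices of [U] are non-adjacent, or [U] is a clique and all its vertices are
    simplicial. *)
Lemma far_simplicial_ex (U : {set T}) x : has_far_simplicial U -> x \in U ->
  exists2 z, z \in U & simplicial U z.
Proof.
move=> far xU.
case: (boolP [exists a in U, exists b in U, (a != b) && ~~ e a b]).
  move=> /exists_inP[a aU /exists_inP[b bU /andP[nab neab]]].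
  rewrite eq_sym in nab.
  by have [z [zU _ _ sz]] := far a b aU bU nab neab; exists z.
rewrite negb_exists_in => /forall_inP h; exists x => // a b aU bU _ _ nab.
have := h a aU; rewrite negb_exists_in => /forall_inP/(_ b bU).
by rewrite nab negbK.
Qed.

(** Induction on the size of [U]. Let [C] be a component of the non-neighbors of [v], and let [S] be
    the set of its neighbors outside. By [chordal_separator], [S] is a clique. A vertex of [C] that
    is simplicial in [C :|: S] is simplicial in [U], because all its neighbors in [U] lie in
    [C :|: S]; and [C :|: S] is smaller than [U], because it omits [v]. *)
Lemma chordal_far_simplicial (U : {set T}) : has_far_simplicial U.
Proof.
have [n] := ubnP #|U|; elim: n U => // n IH U; rewrite ltnS => Un v w vU wU nwv nevw.
pose W := [set u in U | (u != v) && ~~ e v u].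
have wW : w \in W by rewrite inE wU nwv.
pose C := [set u | connect (restr_rel W) w u].
have CW c : c \in C -> [/\ c \in U, c != v & ~~ e v c].
  by rewrite inE => /(connect_restr_mem wW); rewrite inE => /and3P.
have wC : w \in C by rewrite inE connect0.
pose S := [set s in U | (s \notin C) && [exists c in C, e s c]].
(* A neighbor of [C] that is not adjacent to [v] would lie in [W], and hence in the component
   [C]. *)
have Sv s : s \in S -> e v s.
  rewrite inE => /and3P[sU sC /exists_inP[c cC esc]].
  have [cU cv nevc] := CW c cC; apply: contraNT sC => nevs.
  rewrite inE; apply: connect_trans (connect1 _); first by rewrite inE in cC; exact: cC.
  apply/and3P; split; [by rewrite inE cU cv|rewrite inE sU nevs andbT|by rewrite e_sym].
  by apply: contraNneq nevc => <-.
have Sclique : {in S &, forall s t, s != t -> e s t}.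
  move=> s t sS tS nst; apply: (@chordal_separator v s t C) => //; try exact: Sv.
    by move=> c /CW[_ -> ->].
  set B := s |: _.
  have CB : C \subset B by apply/subsetP => c cC; rewrite !inE in cC *; rewrite cC !orbT.
  have conn c : c \in C -> connect (restr_rel B) w c.
    by rewrite inE => /connect_component; apply: connect_restr_sub.
  have connS x : x \in S -> x \in B -> connect (restr_rel B) w x.
    rewrite inE => /and3P[_ _ /exists_inP[c cC exc]] xB.
    apply: connect_trans (conn c cC) (connect1 _); apply/and3P.
    by split; rewrite // ?(subsetP CB) // e_sym.
  apply: (@connect_trans _ _ w); last by apply: connS; rewrite // !inE eqxx orbT.
  by rewrite connect_restr_sym; apply: connS; rewrite // !inE eqxx.
have DU : C :|: S \subset U.
  by apply/subsetP => x; rewrite inE => /orP[/CW[]|]//; rewrite inE => /andP[].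
have vD : v \notin C :|: S.
  rewrite inE; apply/norP; split; first by apply/negP => /CW[_]; rewrite eqxx.
  by apply/negP => /Sv; rewrite e_irr.
have Dn : #|C :|: S| < n.
  apply: leq_trans Un; apply: proper_card; apply/properP; split => //.
  by exists v.
have lift z : z \in C -> simplicial (C :|: S) z ->
    exists z, [/\ z \in U, z != v, ~~ e v z & simplicial U z].
  move=> zC sz; have [zU zv nevz] := CW z zC; exists z; split => // a b aU bU eza ezb.
  have inD x : x \in U -> e z x -> x \in C :|: S.
    move=> xU ezx; rewrite inE; case: (boolP (x \in C)) => //= nxC.
    by rewrite inE xU nxC; apply/exists_inP; exists z; rewrite // e_sym.
  by apply: sz => //; apply: inD.
(* If some [s] in [S] misses a vertex of [C :|: S], induction gives a simplicial vertex not adjacent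
   to [s]; as [S] is a clique, this vertex lies in [C]. *)
case: (boolP [exists s in S, exists u in C :|: S, (u != s) && ~~ e s u]).
  move=> /exists_inP[s sS /exists_inP[u uD /andP[nus nesu]]].
  have sD : s \in C :|: S by rewrite inE sS orbT.
  have [z [zD zs nesz sz]] := IH _ Dn s u sD uD nus nesu.
  apply: lift sz; move: zD; rewrite inE => /orP[//|zS].
  by case/negP: nesz; apply: Sclique; rewrite // eq_sym.
(* Now each [s] in [S] is adjacent to all other vertices of [C :|: S], so a simplicial vertex of [C]
   remains simplicial in [C :|: S]. *)
rewrite negb_exists_in => /forall_inP Sdom.
have {}Sdom s u : s \in S -> u \in C :|: S -> u != s -> e s u.
  move=> sS uD nus; have := Sdom s sS; rewrite negb_exists_in => /forall_inP/(_ u uD).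
  by rewrite nus negbK.
have [z zC sz] : exists2 z, z \in C & simplicial C z.
  apply: far_simplicial_ex wC; apply: IH; apply: leq_ltn_trans Dn.
  by apply: subset_leq_card; apply: subsetUl.
apply: (lift z zC) => a b aD bD eza ezb nab.
move: (aD); rewrite inE => /orP[aC|aS]; last by apply: Sdom => //; rewrite eq_sym.
move: (bD); rewrite inE => /orP[bC|bS]; first exact: sz.
by rewrite e_sym; apply: Sdom.
Qed.

(** Vertices are eliminated from the largest rank downwards: the neighbors of smaller rank form a
    clique. *)
Definition elimination_order (U : {set T}) (r : T -> nat) : Prop :=
  {in U &, injective r} /\
  {in U & &, forall z a b, e z a -> e z b -> r a < r z -> r b < r z -> a != b -> e a b}.

Lemma elimination_order_ex (U : {set T}) :
  exists2 r, elimination_order U r & {in U, forall x, r x < #|U|}.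
Proof.
have [n] := ubnP #|U|; elim: n U => // n IH U; rewrite ltnS => Un.
have [->|[x xU]] := set_0Vmem U.
  by exists (fun=> 0); [split => y|move=> y]; rewrite inE.
have [z zU sz] := far_simplicial_ex (chordal_far_simplicial (U := U)) xU.
have cU : #|U| = #|U :\ z|.+1 by rewrite (cardsD1 z U) zU.
have [|r [rI rP] rU] := IH (U :\ z); first by rewrite -cU.
have inD x' : x' \in U -> x' != z -> x' \in U :\ z by rewrite !inE => -> ->.
(* The simplicial vertex is put last; by the bound carried through the induction, [#|U :\ z|]
   exceeds all other ranks. *)
exists (fun x => if x == z then #|U :\ z| else r x).
  split.
    move=> a b aU bU; case: eqP => [->|/eqP na]; case: eqP => [->|/eqP nb] //.
    - by move=> h; have := rU b (inD b bU nb); rewrite -h ltnn.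
    - by move=> h; have := rU a (inD a aU na); rewrite h ltnn.
    - by apply: rI; apply: inD.
  move=> y a b yU aU bU eya eyb; case: (eqVneq y z) => [yz|ny].
    by move=> _ _ nab; apply: sz; rewrite // -yz.
  have ry := rU y (inD y yU ny).
  case: (eqVneq a z) => [_ h|na]; first by have := ltn_trans h ry; rewrite ltnn.
  case: (eqVneq b z) => [_ _ h|nb]; first by have := ltn_trans h ry; rewrite ltnn.
  by apply: rP => //; apply: inD.
move=> y yU; rewrite cU; case: eqP => // /eqP ny; exact: leqW (rU y (inD y yU ny)).
Qed.

(** * Smaller neighbors in connected subgraphs *)

Section SmallerNeighbor.
Variable r : T -> nat.
Hypothesis r_elim : elimination_order [set: T] r.

Lemma elim_order_inj : injective r.
Proof. by move=> x y; apply: r_elim.1; rewrite inE. Qed.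

(** A simple path through [z] enters and leaves it by two distinct neighbors of smaller rank; these
    are adjacent, so [z] can be bypassed. *)
Lemma connected_del_max (U : {set T}) z : connected_in e U -> z \in U ->
  {in U, forall x, r x <= r z} -> connected_in e (U :\ z).
Proof.
move=> /connected_inP cU zU zmax; apply/connected_inP => x y.
rewrite !inE => /andP[nx xU] /andP[ny yU].
have /connectP[p0 pp0] := cU x y xU yU.
case/shortenP: pp0 => p pp up _ {p0} ly; apply/connectP.
have pU : {in p, forall a, a \in U}.
  elim: (p) x pp {nx xU up ly} => //= a q IH x /andP[/and3P[_ aU _] pq] b.
  by rewrite inE => /orP[/eqP->//|]; apply: IH pq b.
have weak q a : a \in U -> a != z -> {subset q <= U} -> z \notin q ->
    path (restr_rel U) a q -> path (restr_rel (U :\ z)) a q.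
  elim: q a => //= b q IH a aU na qU; rewrite inE negb_or eq_sym => /andP[nb zq].
  case/andP => /and3P[_ bU eab] pq; rewrite IH //.
    by rewrite /restr_rel /= !inE na nb aU bU eab.
  by move=> c cq; apply: qU; rewrite inE cq orbT.
case: (boolP (z \in p)) => [zp|zp]; last by exists p => //; apply: weak.
move: zp pp up ly pU; case/splitPr => p1 p2; rewrite cat_path last_cat /=.
case: p2 => [|b p2] /=; first by move=> _ _ h; rewrite h eqxx in ny.
set a := last x p1; move=> /and3P[pp1 /and3P[_ _ eaz] /andP[/and3P[_ _ ezb] pp2]] up ly pU.
have ap1 : a \in x :: p1 by apply: mem_last.
have aU : a \in U.
  by move: ap1; rewrite inE => /orP[/eqP->//|h]; apply: pU; rewrite mem_cat h.
have bU : b \in U by apply: pU; rewrite mem_cat !inE eqxx !orbT.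
have {up} : uniq ((x :: p1) ++ z :: b :: p2) := up; rewrite cat_uniq.
case/and3P => _ dis /= /and3P[]; rewrite inE negb_or => /andP[nzb zp2] bp2 up2.
move: dis; rewrite -all_predC /= => /and3P[zp1 bp1 _].
have naz : a != z by apply: contraNneq zp1 => <-.
have nab : a != b by apply: contraNneq bp1 => <-.
have lt c : c \in U -> c != z -> r c < r z.
  move=> cU' ncz; rewrite ltn_neqAle zmax // andbT; apply: contra ncz => /eqP h.
  by apply/eqP/elim_order_inj.
exists (p1 ++ b :: p2); last by rewrite last_cat.
rewrite cat_path /=; apply/and3P; split.
- apply: weak => //; first by move=> c cp; apply: pU; rewrite mem_cat cp.
  by apply: contra zp1 => h; rewrite inE h orbT.
- rewrite -/a /restr_rel /= !inE naz aU bU (eq_sym b) nzb /=.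
  apply: (r_elim.2 z) => //; rewrite ?inE //; first by rewrite e_sym.
    exact: lt.
  by apply: lt; rewrite // eq_sym.
- apply: weak => //; first by rewrite eq_sym.
  by move=> c cp; apply: pU; rewrite mem_cat !inE cp !orbT.
Qed.

(** Vertices of rank above [t] are deleted, the largest first, which keeps the graph connected. Once
    [t] is the largest, any neighbor will do, and [u0] ensures that there is one. *)
Lemma smaller_neighbor (U : {set T}) t u0 : connected_in e U ->
  t \in U -> u0 \in U -> r u0 < r t -> exists u, [/\ u \in U, r u < r t & e u t].
Proof.
have [n] := ubnP #|U|; elim: n U => // n IH U; rewrite ltnS => Un cU tU u0U lt0.
case: (boolP [exists x in U, r t < r x]) => [/exists_inP[x xU ltx]|].
  have [z zU zmax] : exists2 z, z \in U & {in U, forall x, r x <= r z}.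
    by case: (arg_maxnP r tU) => z zU zmax; exists z.
  have ltz : r t < r z := leq_trans ltx (zmax x xU).
  have [|||||u [uU ltu eut]] := IH (U :\ z).
  - by apply: leq_trans Un; rewrite (cardsD1 z U) zU.
  - exact: connected_del_max.
  - by rewrite !inE tU andbT; apply: contraTneq ltz => ->; rewrite ltnn.
  - by rewrite !inE u0U andbT; apply: contraTneq (ltn_trans lt0 ltz) => ->; rewrite ltnn.
  - exact: lt0.
  by exists u; split => //; move: uU; rewrite inE => /andP[].
rewrite negb_exists_in => /forall_inP tmax.
have /connectP[p] := connected_inP _ cU t u0 tU u0U.
case: p => [_ h|a p /= /andP[/and3P[_ aU eta] _] _]; first by rewrite h ltnn in lt0.
exists a; split => //; last by rewrite e_sym.
rewrite ltn_neqAle leqNgt tmax // andbT; apply: contraTneq eta => /elim_order_inj ->.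
by rewrite e_irr.
Qed.

End SmallerNeighbor.

End Elimination.

(** The form in which chordality enters the rest of the proof. *)
Theorem chordal_smaller_neighbor (T : finType) (e : rel T) :
  symmetric e -> irreflexive e -> chordal e ->
  exists2 r : T -> nat, injective r &
    forall (U : {set T}) t u0, connected_in e U -> t \in U -> u0 \in U -> r u0 < r t ->
      exists u, [/\ u \in U, r u < r t & e u t].
Proof.
move=> e_sym e_irr e_chordal.
have [r rP _] := elimination_order_ex e_sym e_irr e_chordal [set: T].
by exists r; [apply: elim_order_inj rP|move=> U t u0; apply: smaller_neighbor].
Qed.

From mathcomp Require Import all_algebra.

Import GRing.Theory.
Local Open Scope ring_scope.

(** * Orderings weighted by their runs *)

Section Runs.
Variables (A : eqType) (key : A -> nat).

Definition key_gt : rel A := fun x y => (key y < key x)%N.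

(* The head of the list [t] is the element added last, so that an increasing run
   of the ordering is a decreasing segment of [t]. *)
Fixpoint runs (t : seq A) : seq nat :=
  if t is x :: t' then
    if (t', runs t') is (y :: _, k :: ks) then
      if key_gt x y then k.+1 :: ks else 1%N :: k :: ks
    else [:: 1%N]
  else [::].

Lemma runs_cons2 x y t : runs [:: x, y & t] =
  if key_gt x y then (head 0 (runs (y :: t))).+1%N :: behead (runs (y :: t))
  else 1%N :: runs (y :: t).
Proof.
have -> : runs [:: x, y & t] = if runs (y :: t) is k :: ks then
    if key_gt x y then k.+1 :: ks else 1%N :: k :: ks else [:: 1%N] by [].
by case: (runs (y :: t)) => [|k ks] //=; case: ifP.
Qed.

Lemma head_runs_gt0 x t : (0 < head 0 (runs (x :: t)))%N.
Proof. by case: t => [|y t] //; rewrite runs_cons2; case: ifP. Qed.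

Lemma runsE x t : runs (x :: t) =
  head 0%N (runs (x :: t)) :: behead (runs (x :: t)).
Proof. by have := head_runs_gt0 x t; case: (runs _). Qed.

Lemma sumn_runs t : sumn (runs t) = size t.
Proof.
elim: t => // x [|y t] // IH; rewrite runs_cons2; case: ifP => _ /=; rewrite -[RHS]/(size (y :: t)).+1 -IH //.
by rewrite runsE.
Qed.

(** The first entry of [runs t] is the length of the longest initial segment of [t] along which the
    keys decrease. *)
Lemma sorted_take_runs t k : (k <= size t)%N ->
  sorted key_gt (take k t) = (k <= head 0 (runs t))%N.
Proof.
elim: t k => [|x t IH] [|k] //; rewrite [size _]/= ltnS => kt.
case: t IH kt => [|y t] IH kt; first by rewrite leqn0 in kt; rewrite (eqP kt).
rewrite runs_cons2; case: k kt => [|k] kt; first by case: ifP.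
have := IH k.+1 kt; rewrite /=; by case: ifP.
Qed.

Lemma runs_drop t k : (k < head 0 (runs t))%N ->
  runs (drop k t) = (head 0 (runs t) - k)%N :: behead (runs t).
Proof.
elim: t k => [|x t IH] [|k] //; first by rewrite drop0 subn0 -runsE.
case: t IH => [|y t] IH //; rewrite runs_cons2; case: ifP => //= _.
by rewrite ltnS => kt; rewrite subSS -IH.
Qed.

Lemma runs_drop_head t : runs (drop (head 0%N (runs t)) t) = behead (runs t).
Proof.
elim: t => // x t IH; case: t IH => [|y t] IH //.
by rewrite runs_cons2; case: ifP => _ //=; rewrite ?drop0.
Qed.

Variables (R : comNzRingType) (ee hh : nat -> R).
Hypothesis ee0 : ee 0 = 1.
Hypothesis hh_ee : forall n, (0 < n)%N ->
  \sum_(i < n.+1) (-1) ^+ i * hh i * ee (n - i) = 0.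

Definition runs_weight (t : seq A) : R := \prod_(k <- runs t) ee k.

(** Only the cuts within the first run, of length [l], contribute. A cut at i shortens this run to l
    - i and leaves the other runs alone, so [hh_ee] for [l] can be factored out. *)
Lemma sum_runs_weight t : (0 < size t)%N ->
  \sum_(i < (size t).+1 | sorted key_gt (take i t))
    (-1) ^+ i * hh i * runs_weight (drop i t) = 0.
Proof.
case: t => // x t _; set l := head 0%N (runs (x :: t)).
have lt : (l <= size (x :: t))%N by rewrite -sumn_runs runsE /= leq_addr.
transitivity ((\sum_(i < l.+1) (-1) ^+ i * hh i * ee (l - i)) *
    \prod_(k <- behead (runs (x :: t))) ee k); last by rewrite hh_ee ?mul0r ?head_runs_gt0.
rewrite mulr_suml (big_ord_widen (size (x :: t)).+1
  (fun i => (-1) ^+ i * hh i * ee (l - i) * \prod_(k <- behead (runs (x :: t))) ee k)) //.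
apply: eq_big => [i|i]; rewrite sorted_take_runs -1?ltnS // => il.
rewrite -[RHS]mulrA; congr (_ * _); rewrite /runs_weight.
have [il'|li] := ltnP i l; first by rewrite runs_drop // big_cons.
(* The cut at [l] removes the whole run; the general formula still holds because [ee 0] is 1. *)
have {il li} -> : nat_of_ord i = l by apply/eqP; rewrite eqn_leq li andbT.
by rewrite runs_drop_head subnn ee0 mul1r.
Qed.

End Runs.

(** * Signed sums over the orderings of subsets *)

Section Orderings.
Variables (A : finType) (key : A -> nat).
Hypothesis key_inj : injective key.
Variable feasible : pred {set A}.

(** As the head of the list is added last, the suffixes of [t] are the prefixes of the ordering; all
    of them, the empty one included, have to be feasible. *)
Fixpoint feasible_seq (t : seq A) : bool :=
  feasible [set x in t] && (if t is _ :: t' then feasible_seq t' else true).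

Lemma feasible_seq_set t : feasible_seq t -> feasible [set x in t].
Proof. by case: t => [|x t] /andP[]. Qed.

Variables (R : comNzRingType) (ee hh : nat -> R).
Hypothesis ee0 : ee 0 = 1.
Hypothesis hh_ee : forall n, (0 < n)%N ->
  \sum_(i < n.+1) (-1) ^+ i * hh i * ee (n - i) = 0.

Definition ordering_sum (S : {set A}) : R :=
  \sum_(t <- permutations (enum S) | feasible_seq t) runs_weight key ee t.

(** Putting this list in front of another one appends [X] to the ordering by increasing keys. *)
Definition decreasing (X : {set A}) : seq A :=
  sort (fun x y => key y <= key x)%N (enum X).

Lemma mem_decreasing X : decreasing X =i X.
Proof. by move=> x; rewrite mem_sort mem_enum. Qed.

Lemma decreasing_uniq X : uniq (decreasing X).
Proof. by rewrite sort_uniq enum_uniq. Qed.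

Lemma decreasing_sorted X : sorted (key_gt key) (decreasing X).
Proof.
have := sort_sorted (fun x y => leq_total (key y) (key x)) (enum X).
rewrite -/(decreasing X) sorted_pairwise; last by move=> y x z h1 h2; apply: leq_trans h2 h1.
rewrite sorted_pairwise; last by move=> y x z h1 h2; apply: ltn_trans h2 h1.
have := decreasing_uniq X; rewrite uniq_pairwise.
elim: (decreasing X) => //= x s IH /andP[h1 h2] /andP[h3 h4]; rewrite IH // andbT.
apply/allP => y ys; rewrite /key_gt ltn_neqAle (allP h3 y ys) andbT.
by apply: contra (allP h1 y ys) => /eqP/key_inj ->.
Qed.

Lemma decreasing_eq (X : {set A}) s :
  uniq s -> s =i X -> sorted (key_gt key) s -> s = decreasing X.
Proof.
move=> us sX ss; apply: (@sorted_eq _ (key_gt key)) => //.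
- by move=> y x z h1 h2; apply: ltn_trans h2 h1.
- by move=> x y /andP[h1 h2]; have := ltn_trans h1 h2; rewrite ltnn.
- exact: decreasing_sorted.
- by apply: uniq_perm => //; [exact: decreasing_uniq|move=> x; rewrite sX mem_decreasing].
Qed.

Lemma perm_enumP (S : {set A}) t : reflect (uniq t /\ t =i S) (t \in permutations (enum S)).
Proof.
rewrite mem_permutations; apply: (iffP idP) => [h|[ut tS]].
  by split; [rewrite (perm_uniq h) enum_uniq|move=> x; rewrite (perm_mem h) mem_enum].
by apply: uniq_perm => //; [exact: enum_uniq|move=> x; rewrite tS mem_enum].
Qed.

Variable S : {set A}.
Hypothesis feasible_extend : forall (S0 : {set A}) x, S0 \subset S -> feasible S0 ->
  x \in S :\: S0 -> {in S :\: S0, forall y, key x <= key y}%N -> feasible (x |: S0).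

(** Each element of [u] has, when it is added, the least key among the elements not yet placed,
    which is the case covered by [feasible_extend]. *)
Lemma feasible_seq_extend u t : uniq (u ++ t) -> {subset u ++ t <= S} ->
  sorted (key_gt key) u ->
  {in S, forall y, y \notin u ++ t -> {in u, forall x, key x < key y}%N} ->
  feasible_seq t -> feasible_seq (u ++ t).
Proof.
elim: u => //= x u IH /andP[xut uut] utS su lt ft.
have ltx : {in u, forall y, key y < key x}%N.
  apply/allP; apply: order_path_min su => a b c h1 h2; exact: ltn_trans h2 h1.
have xS : x \in S by apply: utS; rewrite inE eqxx.
have utS' : {subset u ++ t <= S} by move=> y h; apply: utS; rewrite inE h orbT.
have fut : feasible_seq (u ++ t).
  apply: IH => //; first exact: path_sorted su.
  move=> y yS yut z zu; have [->|nyx] := eqVneq y x; first exact: ltx.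
  by apply: lt => //; rewrite ?inE ?negb_or ?nyx ?zu ?orbT.
rewrite fut andbT set_cons; apply: feasible_extend.
- by apply/subsetP => y; rewrite inE; apply: utS'.
- exact: feasible_seq_set.
- by rewrite !inE xut.
- move=> y; rewrite !inE => /andP[yut yS]; have [->//|nyx] := eqVneq y x.
  by apply: ltnW; apply: lt; rewrite ?inE ?negb_or ?nyx ?eqxx.
Qed.

(** The pairs of a subset and a feasible ordering of it correspond to the feasible orderings of all
    of [S] with a marked cut inside the last run or at its ends. For a fixed ordering, the sum over
    the cuts is 0. *)
Lemma sum_ordering_sum : S != set0 ->
  \sum_(S0 : {set A} | S0 \subset S)
    (-1) ^+ #|S :\: S0| * hh #|S :\: S0| * ordering_sum S0 = 0.
Proof.
move=> nS.
pose F (p : seq A * nat) := (-1) ^+ p.2 * hh p.2 * runs_weight key ee (drop p.2 p.1).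
pose L1 := [seq (S0, t) | S0 : {set A} <- enum (powerset S), t : seq A <- permutations (enum S0)].
pose L2 := [seq (t, k) | t <- permutations (enum S), k <- iota 0 #|S|.+1].
pose L1' := [seq p <- L1 | feasible_seq p.2].
pose L2' := [seq p <- L2 | feasible_seq p.1 && sorted (key_gt key) (take p.2 p.1)].
(* The bijection completes an ordering of a subset by the rest of [S] and records the number of
   elements added; cutting there recovers the pair. *)
pose f (p : {set A} * seq A) := (decreasing (S :\: p.1) ++ p.2, #|S :\: p.1|).
have szd (X : {set A}) : size (decreasing X) = #|X| by rewrite size_sort cardE.
have fdrop p : drop (f p).2 (f p).1 = p.2 by rewrite /f drop_size_cat.
have ftake p : take (f p).2 (f p).1 = decreasing (S :\: p.1) by rewrite /f take_size_cat.
have L1P p : p \in L1 -> [/\ p.1 \subset S, uniq p.2 & p.2 =i p.1].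
  case/allpairsPdep => S0 [t [+ /perm_enumP[ut tS] ->]].
  by rewrite mem_enum inE.
have pm : perm_eq (map f L1') L2'.
  apply: uniq_perm.
  - rewrite map_inj_in_uniq.
      apply: filter_uniq; apply: allpairs_uniq_dep; first exact: enum_uniq.
        by move=> S0 _; apply: permutations_uniq.
      by move=> [? ?] [? ?] _ _ /= [-> ->].
    move=> p q; rewrite !mem_filter => /andP[_ /L1P[_ _ p2]] /andP[_ /L1P[_ _ q2]] h.
    have h2 : p.2 = q.2 by rewrite -(fdrop p) -(fdrop q) h.
    rewrite [p]surjective_pairing [q]surjective_pairing h2; congr pair.
    by apply/setP => x; rewrite -p2 -q2 h2.
  - apply: filter_uniq; apply: allpairs_uniq_dep; first exact: permutations_uniq.
      by move=> t _; apply: iota_uniq.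
    by move=> [? ?] [? ?] _ _ /= [-> ->].
  - move=> [t k]; apply/mapP/idP => [[p + ->]|].
      rewrite mem_filter => /andP[fp /L1P[pS up pE]]; rewrite mem_filter ftake decreasing_sorted andbT.
      have uE : uniq (f p).1.
        rewrite cat_uniq decreasing_uniq up andbT; apply/hasPn => x.
        by rewrite mem_decreasing inE pE => ->.
      have mE : (f p).1 =i S.
        move=> x; rewrite mem_cat mem_decreasing pE inE.
        by case: (boolP (x \in p.1)) => [/(subsetP pS)->|_]; rewrite ?orbT ?orbF.
      apply/andP; split.
        apply: feasible_seq_extend => //; first by move=> x; rewrite -/(f p).1 mE.
          exact: decreasing_sorted.
        by move=> y yS; rewrite mem_cat mem_decreasing pE inE yS andbT orNb.
      apply/allpairsPdep; exists (f p).1, (f p).2; split=> //; first exact/perm_enumP.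
      by rewrite mem_iota add0n ltnS subset_leq_card // subsetDl.
    rewrite mem_filter => /andP[/andP[/= ft st]].
    case/allpairsPdep => t' [k' [/perm_enumP[ut tS] + [et ek]]]; rewrite -{}et -{}ek in ut tS *.
    rewrite mem_iota add0n ltnS => kS.
    have szt : size t = #|S| by rewrite -(card_uniqP ut); apply: eq_card.
    pose S0 := [set x in drop k t].
    have SD : take k t =i S :\: S0.
      move: ut; rewrite -{1}(cat_take_drop k t) cat_uniq => /and3P[_ /hasPn dis _].
      move=> x; rewrite !inE -tS -{3}(cat_take_drop k t) mem_cat.
      by case: (boolP (x \in drop k t)) => [/dis/negbTE->|_]; rewrite ?orbF.
    have cD : #|S :\: S0| = k.
      by rewrite -(eq_card SD) (card_uniqP _) ?take_uniq // size_takel // szt.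
    have dE : decreasing (S :\: S0) = take k t by rewrite -(decreasing_eq _ SD) ?take_uniq.
    exists (S0, drop k t); last by rewrite /f /= cD dE cat_take_drop.
    rewrite mem_filter /=; apply/andP; split.
      elim: (k) (t) ft => [|n IH] [|x s] //.
      by move=> /andP[_]; apply: IH.
    apply/allpairsPdep; exists S0, (drop k t); split=> //.
      rewrite mem_enum inE; apply/subsetP => x; rewrite inE -tS; exact: mem_drop.
    by apply/perm_enumP; split; [exact: drop_uniq|move=> x; rewrite inE].
transitivity (\sum_(p <- map f L1') F p).
  rewrite big_map big_filter [RHS]big_mkcond /L1 big_allpairs_dep /= big_enum /=.
  apply: eq_big => [S0|S0 _]; first by rewrite inE.
  rewrite mulr_sumr big_mkcond; apply: eq_bigr => t _.
  by have := fdrop (S0, t); rewrite /F /= => ->.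
rewrite (perm_big _ pm) big_filter big_mkcond /L2 big_allpairs_dep big_seq big1 // => t.
move=> /perm_enumP[ut tS].
have szt : size t = #|S| by rewrite -(card_uniqP ut); apply: eq_card.
have t0 : (0 < size t)%N by rewrite szt card_gt0.
case: (boolP (feasible_seq t)) => ft /=; last by rewrite big1.
apply: etrans (sum_runs_weight key ee0 hh_ee t0); rewrite szt /= -big_mkcond.
by rewrite -[0%N :: _]/(index_iota 0 #|S|.+1) big_mkord.
Qed.

End Orderings.

(** * The block functions *)

Section PartitionFacts.
Variable T : finType.
Implicit Types (P Q : {set {set T}}) (A B C D : {set T}).

Lemma partition_charP P D : reflect
  [/\ forall A, A \in P -> A != set0 /\ A \subset D,
      forall x, x \in D -> exists2 A, A \in P & x \in A
    & forall A B x, A \in P -> B \in P -> x \in A -> x \in B -> A = B]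
  (partition P D).
Proof.
apply: (iffP and3P) => [[/eqP cv tI n0]|[sub ex un]]; split.
- move=> A AP; split; first by apply: contraNneq n0 => <-.
  by rewrite -cv; apply: bigcup_sup.
- by move=> x; rewrite -cv => /bigcupP[A]; exists A.
- by move=> A B x AP BP xA xB; rewrite -(def_pblock tI AP xA) -(def_pblock tI BP xB).
- apply/eqP/setP => x; apply/bigcupP/idP => [[A AP]|/ex[A]]; last by exists A.
  by apply: subsetP; have [] := sub A AP.
- apply/trivIsetP => A B AP BP; apply: contraR => /pred0Pn[x /andP[/= xA xB]].
  by rewrite (un A B x).
- by apply/negP => /sub[]; rewrite eqxx.
Qed.

Lemma mem_coverP P x : reflect (exists2 A, A \in P & x \in A) (x \in cover P).
Proof. exact: bigcupP. Qed.

Lemma partition_pblock P D x : partition P D -> x \in D ->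
  pblock P x \in P /\ x \in pblock P x.
Proof.
by case/and3P => /eqP <- _ _ xD; rewrite pblock_mem // mem_pblock.
Qed.

Lemma partition_set0E P : partition P set0 = (P == set0).
Proof.
apply/partition_charP/eqP => [[sub _ _]|->]; last first.
  by split => [A|x|A B x]; rewrite inE.
apply/setP => A; rewrite inE; apply/negP => /sub[+]; rewrite subset0.
by move=> /negP.
Qed.

End PartitionFacts.

(** * Exchanging a partition of the root block for a subset of blocks *)

Section RootedPairs.
Variables (T : finType) (C : {set T}) (v : T).
Hypothesis vC : v \in C.
Implicit Types (A B D X Y : {set T}) (P Q S : {set {set T}}).

(* The pairs of a partition P of C and a partition S of the block of v in P, with
   v removed, correspond to the pairs of a partition Q of C \ v and a subset S
   of Q. *)
Definition merge_root Q S : {set {set T}} := (v |: cover S) |: (Q :\: S).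
Definition split_root P S : {set {set T}} := S :|: (P :\ pblock P v).

Lemma partition_subset_cover Q S D : partition Q D -> S \subset Q -> partition S (cover S).
Proof.
case/partition_charP => sub ex un SQ; apply/partition_charP; split.
- move=> A AS; split; first by case: (sub A (subsetP SQ A AS)).
  by apply: bigcup_sup.
- by move=> x /mem_coverP[A]; exists A.
- by move=> A B x /(subsetP SQ) AQ /(subsetP SQ) BQ; apply: un.
Qed.

Lemma root_notin_cover Q S : partition Q (C :\ v) -> S \subset Q -> v \notin cover S.
Proof.
case/partition_charP => sub _ _ SQ; apply/mem_coverP => -[A /(subsetP SQ)/sub[_ /subsetP AC] /AC].
by rewrite !inE eqxx.
Qed.

Lemma merge_root_block Q S : partition Q (C :\ v) -> v |: cover S \notin Q :\: S.
Proof.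
case/partition_charP => sub _ _; rewrite inE; apply/negP => /andP[_ /sub[_ /subsetP/(_ v)]].
by rewrite !inE eqxx => /(_ isT).
Qed.

Lemma merge_root_partition Q S : partition Q (C :\ v) -> S \subset Q ->
  partition (merge_root Q S) C.
Proof.
move=> pQ SQ; case/partition_charP: (pQ) => sub ex un; apply/partition_charP.
have vS := root_notin_cover pQ SQ.
have outS A x : A \in Q :\: S -> x \in A -> x \notin v |: cover S.
  rewrite inE => /andP[AS AQ] xA; rewrite !inE negb_or; apply/andP; split.
    by have [_ /subsetP/(_ x xA)] := sub A AQ; rewrite !inE => /andP[].
  apply/mem_coverP => -[B BS xB].
  by move: AS; rewrite (un A B x AQ (subsetP SQ B BS) xA xB) BS.
split.
- move=> A; rewrite !inE => /orP[/eqP->|/andP[_ /sub[An AC]]]; last first.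
    by split => //; apply: subset_trans AC (subsetDl _ _).
  split; first by apply/set0Pn; exists v; rewrite !inE eqxx.
  apply/subsetP => x; rewrite !inE => /orP[/eqP->//|/mem_coverP[B BS xB]].
  by have [_ /subsetP/(_ x xB)] := sub B (subsetP SQ B BS); rewrite !inE => /andP[].
- move=> x xC; case: (boolP (x \in v |: cover S)) => [xv|].
    by exists (v |: cover S); rewrite // !inE eqxx.
  rewrite !inE negb_or => /andP[nxv xS]; have [|A AQ xA] := ex x; first by rewrite !inE nxv.
  exists A => //; rewrite !inE AQ andbT; apply/orP; right.
  by apply: contra xS => AS; apply/mem_coverP; exists A.
- move=> A B x /setU1P[->|AQ] /setU1P[->|BQ] // xA xB.
  + by have := outS B x BQ xB; rewrite xA.
  + by have := outS A x AQ xA; rewrite xB.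
  + by move: AQ BQ; rewrite !inE => /andP[_ AQ] /andP[_ BQ]; apply: un xA xB.
Qed.

Lemma merge_root_pblock Q S : partition Q (C :\ v) -> S \subset Q ->
  pblock (merge_root Q S) v = v |: cover S.
Proof.
move=> pQ SQ; have /and3P[_ tI _] := merge_root_partition pQ SQ.
by apply: def_pblock tI _ _; rewrite !inE eqxx.
Qed.

Lemma merge_rootK Q S : partition Q (C :\ v) -> S \subset Q ->
  split_root (merge_root Q S) S = Q.
Proof.
move=> pQ SQ; rewrite /split_root merge_root_pblock // /merge_root setU1K ?merge_root_block //.
by rewrite setDE setUIr setUCr setIT; apply/setUidPr.
Qed.

Lemma merge_root_split Q S : partition Q (C :\ v) -> S \subset Q ->
  partition S (pblock (merge_root Q S) v :\ v).
Proof.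
move=> pQ SQ; rewrite merge_root_pblock // setU1K ?(root_notin_cover pQ SQ) //.
exact: partition_subset_cover pQ SQ.
Qed.

Section Split.
Variables (P S : {set {set T}}).
Hypotheses (pP : partition P C) (pS : partition S (pblock P v :\ v)).

Lemma split_root_disjoint : S :&: (P :\ pblock P v) = set0.
Proof.
have [bP vb] := partition_pblock pP vC.
case/partition_charP: pS => subS _ _; case/partition_charP: pP => _ _ unP.
apply/setP => A; rewrite !inE; apply/negP => /and3P[AS Ab AP].
have [/set0Pn[x xA] /subsetP/(_ x xA)] := subS A AS.
rewrite !inE => /andP[_ xb]; case/negP: Ab; apply/eqP; exact: unP xA xb.
Qed.

Lemma split_rootD : split_root P S :\: S = P :\ pblock P v.
Proof.
rewrite /split_root setDUl setDv set0U; apply/setDidPl.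
by rewrite disjoint_sym -setI_eq0 split_root_disjoint.
Qed.

Lemma split_rootK : merge_root (split_root P S) S = P.
Proof.
have [bP vb] := partition_pblock pP vC.
by rewrite /merge_root split_rootD (cover_partition pS) !setD1K.
Qed.

Lemma split_root_partition : partition (split_root P S) (C :\ v).
Proof.
have [bP vb] := partition_pblock pP vC.
case/partition_charP: pS => subS exS unS; case/partition_charP: pP => subP exP unP.
have out A x : A \in P :\ pblock P v -> x \in A -> x \notin pblock P v.
  rewrite !inE => /andP[/eqP nA AP] xA; apply/negP => xb; apply: nA; exact: unP xA xb.
apply/partition_charP; split.
- move=> A /setUP[/subS[An Ab]|AP]; split=> //.
  + by apply: subset_trans Ab _; apply: setSD; have [] := subP _ bP.
  + by move: AP; rewrite !inE => /andP[_ /subP[]].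
  + apply/subsetP => x xA; rewrite !inE; apply/andP; split.
      by apply: contraNneq (out A x AP xA) => ->.
    by move: AP; rewrite !inE => /andP[_ /subP[_ /subsetP]]; apply.
- move=> x; rewrite !inE => /andP[nxv xC]; case: (boolP (x \in pblock P v)) => xb.
    by have [|A AS xA] := exS x; [rewrite !inE nxv|exists A; rewrite // inE AS].
  have [A AP xA] := exP x xC; exists A; rewrite // !inE AP andbT; apply/orP; right.
  by apply: contraNneq xb => <-.
- have outS A x : A \in S -> x \in A -> x \in pblock P v.
    by move=> /subS[_ /subsetP h] /h; rewrite inE => /andP[].
  move=> A B x /setUP[AS|AP] /setUP[BS|BP] xA xB; first exact: unS xA xB.
  + by have := out B x BP xB; rewrite (outS A).
  + by have := out A x AP xA; rewrite (outS B).
  + by move: AP BP; rewrite !inE => /andP[_ AP] /andP[_ BP]; apply: unP xA xB.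
Qed.

End Split.

Lemma big_root_pairs (R : comNzRingType) (F : {set {set T}} -> {set {set T}} -> R) :
  \sum_(P | partition P C) \sum_(S | partition S (pblock P v :\ v)) F P S =
  \sum_(Q | partition Q (C :\ v)) \sum_(S : {set {set T}} | S \subset Q) F (merge_root Q S) S.
Proof.
rewrite !pair_big_dep /=.
rewrite (reindex_onto (fun q : _ * _ => (merge_root q.1 q.2, q.2))
  (fun p : _ * _ => (split_root p.1 p.2, p.2))); last first.
  by move=> [P S] /andP[pP pS] /=; rewrite split_rootK.
apply: eq_bigl => -[Q S] /=; apply/andP/andP => [[/andP[pP pS] /eqP[hQ]]|[pQ SQ]].
  by rewrite -hQ split_root_partition ?subsetUl.
rewrite merge_root_partition // merge_root_split //; split=> //.
by rewrite merge_rootK.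
Qed.

End RootedPairs.

(** * The recursion for the block functions *)

Section ConnectedRecursion.
Variables (T : finType) (e : rel T).
Implicit Types (A B C D X Y : {set T}) (P Q S : {set {set T}}).
Hypothesis e_sym : symmetric e.
Variable r : T -> nat.
Hypothesis r_inj : injective r.
Hypothesis r_nbr : forall (U : {set T}) t u0, connected_in e U -> t \in U -> u0 \in U ->
  (r u0 < r t)%N -> exists u, [/\ u \in U, (r u < r t)%N & e u t].

Definition root (B : {set T}) : option T := [pick v in B | [forall u in B, r v <= r u]%N].

Variant root_spec (B : {set T}) : option T -> Prop :=
  | RootSome v of v \in B & {in B, forall u, r v <= r u}%N : root_spec B (Some v)
  | RootNone of B = set0 : root_spec B None.

Lemma rootP B : root_spec B (root B).
Proof.
rewrite /root; case: pickP => [v /andP[vB /forall_inP h]|none]; first exact: RootSome.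
apply: RootNone; apply/eqP/negPn/negP => /set0Pn[x xB].
case: (arg_minnP r xB) => v vB vmin; case/negP: (negbT (none v)).
by apply/andP; split=> //; apply/forall_inP.
Qed.

Lemma root_uniq (B : {set T}) v : v \in B -> {in B, forall u, r v <= r u}%N -> root B = Some v.
Proof.
move=> vB vmin; case: rootP => [w wB wmin|B0]; last by rewrite B0 inE in vB.
by congr Some; apply/r_inj/eqP; rewrite eqn_leq wmin // vmin.
Qed.

Definition min_rank (B : {set T}) : nat := oapp r 0%N (root B).

(* The summand [enum_rank B] only breaks ties. *)
Definition key (B : {set T}) : nat := (min_rank B * #|{set T}| + enum_rank B)%N.

Lemma key_inj : injective key.
Proof.
move=> A B h; apply/enum_rank_inj/val_inj => /=.
have := congr1 (modn ^~ #|{set T}|) h.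
by rewrite /key !modnMDl !modn_small.
Qed.

Lemma key_le A B : (key A <= key B)%N -> (min_rank A <= min_rank B)%N.
Proof.
move=> h; have := leq_div2r #|{set T}| h.
rewrite /key !divnMDl ?divn_small ?addn0 //; by apply: leq_ltn_trans (ltn_ord (enum_rank A)).
Qed.

Lemma min_rank_le (B : {set T}) x : x \in B -> (min_rank B <= r x)%N.
Proof. by rewrite /min_rank; case: rootP => [v vB vm /vm|->]; rewrite ?inE. Qed.

Lemma min_rank_ex B : B != set0 -> exists2 x, x \in B & r x = min_rank B.
Proof.
by rewrite /min_rank; case: rootP => [v vB _|->]; [exists v|rewrite eqxx].
Qed.

Lemma connected_inU (A B : {set T}) a b : connected_in e A -> connected_in e B ->
  a \in A -> b \in B -> (a = b) \/ e a b -> connected_in e (A :|: B).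
Proof.
move=> /connected_inP cA /connected_inP cB aA bB ab; apply/connected_inP.
have sA := subsetUl A B; have sB := subsetUr A B.
have cab : connect (restr_rel e (A :|: B)) a b.
  case: ab => [->|eab]; first exact: connect0.
  by apply: connect1; apply/and3P; rewrite !inE aA bB orbT.
suff ca x : x \in A :|: B -> connect (restr_rel e (A :|: B)) a x.
  move=> x y xU yU; apply: connect_trans (ca y yU).
  by rewrite connect_restr_sym //; apply: ca.
rewrite inE => /orP[xA|xB]; first exact: connect_restr_sub sA (cA _ _ aA xA).
exact: connect_trans cab (connect_restr_sub sB (cB _ _ bB xB)).
Qed.

Lemma connected_in1 v : connected_in e [set v].
Proof. by apply/connected_inP => x y /set1P-> /set1P->. Qed.

Definition feasible (v : T) (S : {set {set T}}) : bool := connected_in e (v |: cover S).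

(** The least vertex [b] of [X] is not [v], so it has a neighbor [u] of smaller rank in [C]. If [u]
    is not [v], its block has a smaller key than [X] and so belongs to [S0]. In both cases [X] is
    attached to the connected set already built. *)
Lemma feasible_extend (C : {set T}) v (Q S0 : {set {set T}}) X :
  connected_in e C -> v \in C -> {in C, forall u, r v <= r u}%N ->
  partition Q (C :\ v) -> {in Q, forall B, connected_in e B} ->
  S0 \subset Q -> feasible v S0 -> X \in Q :\: S0 ->
  {in Q :\: S0, forall Y, key X <= key Y}%N -> feasible v (X |: S0).
Proof.
move=> cC vC vmin /partition_charP[Qsub Qex _] cQ S0Q fS0.
rewrite inE => /andP[XS0 XQ] Xmin.
have [Xn0 XC] := Qsub X XQ; have [b bX rb] := min_rank_ex Xn0.
have := subsetP XC b bX; rewrite !inE => /andP[nbv bC].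
have ltvb : (r v < r b)%N.
  by rewrite ltn_neqAle vmin // andbT; apply: contra nbv => /eqP/r_inj->.
have [u [uC ltub eub]] := r_nbr cC bC vC ltvb.
have -> : feasible v (X |: S0) = connected_in e ((v |: cover S0) :|: X).
  by rewrite /feasible /cover bigcup_setU big_set1 setUCA setUC.
apply: (connected_inU fS0 (cQ X XQ) _ bX (or_intror eub)).
rewrite !inE; case: (eqVneq u v) => //= nuv.
have [|Y YQ uY] := Qex u; first by rewrite !inE nuv.
apply/mem_coverP; exists Y => //; apply/negPn/negP => nYS0.
have := key_le (Xmin Y _); rewrite inE nYS0 YQ => /(_ isT); rewrite -rb.
by rewrite leqNgt => /negP; apply; apply: leq_ltn_trans (min_rank_le uY) ltub.
Qed.

Variables (R : comNzRingType) (ee hh : nat -> R).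
Hypothesis ee0 : ee 0 = 1.
Hypothesis hh_ee : forall n, (0 < n)%N ->
  \sum_(i < n.+1) (-1) ^+ i * hh i * ee (n - i) = 0.

Definition rooted_sum (v : T) (S : {set {set T}}) : R :=
  ordering_sum key (feasible v) ee S.

(** Formula (2). The blocks of a partition of [C :\ v] are smaller than [C], so the depth [#|C|]
    suffices. *)
Fixpoint phi_rec (n : nat) (C : {set T}) : R :=
  if n is n'.+1 then
    if root C is Some v then
      \sum_(P : {set {set T}} | partition P (C :\ v))
        rooted_sum v P * \prod_(B in P) phi_rec n' B
    else 0
  else 0.

Definition phi (C : {set T}) : R := phi_rec #|C| C.

Lemma partition_card_le (P : {set {set T}}) D B : partition P D -> B \in P -> (#|B| <= #|D|)%N.
Proof. by case/partition_charP => h _ _ /h[_]; apply: subset_leq_card. Qed.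

Lemma phi_rec_stable n C : (#|C| <= n)%N -> phi_rec n C = phi C.
Proof.
rewrite /phi; have [k] := ubnP n; elim: k n C => // k IH n C; rewrite ltnS => nk Cn.
case: n nk Cn => [|n] nk Cn; first by move: Cn; rewrite leqn0 => /eqP->.
case: (set_0Vmem C) => [->|[x xC]].
  by rewrite cards0 /=; case: rootP => // v; rewrite inE.
have [m cm] : exists m, #|C| = m.+1.
  by exists #|C|.-1; rewrite prednK // card_gt0; apply/set0Pn; exists x.
rewrite cm /=; case: rootP => // v vC _; apply: eq_bigr => P pP; congr (_ * _).
have cv : #|C :\ v| = m by have := cardsD1 v C; rewrite vC cm => -[].
have le B : B \in P -> (#|B| <= m)%N by move=> /(partition_card_le pP); rewrite cv.
have mn : (m <= n)%N by rewrite -ltnS -cm.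
apply: eq_bigr => B BP; have Bm := le B BP.
by rewrite (IH n) ?(IH m) // ?(leq_trans Bm) // (leq_ltn_trans mn).
Qed.

Lemma phiE C v : root C = Some v ->
  phi C = \sum_(P : {set {set T}} | partition P (C :\ v))
    rooted_sum v P * \prod_(B in P) phi B.
Proof.
move=> rC; have vC : v \in C by move: rC; case: rootP => // w wC _ [<-].
rewrite /phi; have := cardsD1 v C; rewrite vC add1n => cm; rewrite {1}cm /= rC.
apply: eq_bigr => P pP; congr (_ * _); apply: eq_bigr => B BP.
by rewrite phi_rec_stable // (partition_card_le pP).
Qed.

Lemma phi0 : phi set0 = 0.
Proof. by rewrite /phi cards0. Qed.

Lemma feasible_set0 v : feasible v set0.
Proof. by rewrite /feasible /cover big_set0 setU0 connected_in1. Qed.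

Lemma rooted_sum0 v : rooted_sum v set0 = 1.
Proof.
rewrite /rooted_sum /ordering_sum enum_set0 (_ : permutations [::] = [:: [::]]) //.
rewrite big_mkcond big_seq1 /= andbT (_ : [set x in [::]] = set0).
  by rewrite feasible_set0 /runs_weight big_nil.
by apply/setP => x; rewrite !inE.
Qed.

Lemma phi1 v : phi [set v] = 1.
Proof.
rewrite (@phiE _ v); last by apply: root_uniq => [|u]; rewrite inE // => /eqP->.
rewrite setDv; under eq_bigl do rewrite partition_set0E.
by rewrite big_pred1_eq big_set0 mulr1 rooted_sum0.
Qed.

(** The whole ordering is one of its own prefixes, so its set of blocks has to be feasible. *)
Lemma rooted_sum_disconnected v S : ~~ connected_in e (v |: cover S) -> rooted_sum v S = 0.
Proof.
move=> nc; rewrite /rooted_sum /ordering_sum big_seq_cond big1 // => t.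
case/andP => /perm_enumP[_ tS] /feasible_seq_set; rewrite /feasible.
suff -> : [set x in t] = S by rewrite (negbTE nc).
by apply/setP => x; rewrite inE tS.
Qed.

Lemma phi_disconnected C : ~~ connected_in e C -> phi C = 0.
Proof.
case E : (root C) => [v|]; last by move: E; case: rootP => // -> _ _; rewrite phi0.
move=> nc; rewrite (phiE E) big1 // => P pP; rewrite rooted_sum_disconnected ?mul0r //.
rewrite (cover_partition pP) setD1K //.
by move: E; case: rootP => // w wC _ [<-].
Qed.

Lemma root_ex C : C != set0 ->
  exists v, [/\ root C = Some v, v \in C & {in C, forall u, r v <= r u}%N].
Proof. by case: rootP => [v vC vmin _|->]; [exists v|rewrite eqxx]. Qed.

Lemma phi_sum C : connected_in e C -> (1 < #|C|)%N ->
  \sum_(P | partition P C) (-1) ^+ #|P|.-1 * hh #|P|.-1 * \prod_(B in P) phi B = 0.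
Proof.
move=> cC C1; have Cn0 : C != set0 by rewrite -card_gt0 ltnW.
have [v [rC vC vmin]] := root_ex Cn0.
(* Applied to [P] without the block of [v], this gives the exponent [#|P|.-1]. *)
pose c (S : {set {set T}}) : R := (-1) ^+ #|S| * hh #|S|.
transitivity (\sum_(P | partition P C) \sum_(S | partition S (pblock P v :\ v))
  c (P :\ pblock P v) *
    (rooted_sum v S * \prod_(B in S) phi B * \prod_(B in P :\ pblock P v) phi B)).
  apply: eq_bigr => P pP; have [bP vb] := partition_pblock pP vC.
  (* As the least vertex of [C], [v] is also the least vertex of its block, so (2) applies to that
     block with root [v]. *)
  rewrite -mulr_sumr -mulr_suml -phiE; last first.
    apply: root_uniq => // u ub; apply: vmin.
    by case/partition_charP: pP => /(_ _ bP)[_ /subsetP h] _ _; apply: h.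
  by rewrite -(big_setD1 _ bP) /= /c (cardsD1 (pblock P v) P) bP.
rewrite (big_root_pairs vC (fun P S => c (P :\ pblock P v) *
    (rooted_sum v S * \prod_(B in S) phi B * \prod_(B in P :\ pblock P v) phi B))).
apply: big1 => Q pQ.
transitivity (\prod_(B in Q) phi B * \sum_(S : {set {set T}} | S \subset Q)
    c (Q :\: S) * rooted_sum v S).
  rewrite mulr_sumr; apply: eq_bigr => S SQ.
  rewrite (merge_root_pblock vC pQ SQ) setU1K ?(merge_root_block S pQ) //.
  rewrite [\prod_(B in Q) _](big_setID S) /= (setIidPr SQ).
  by rewrite [RHS]mulrC -!mulrA.
(* A disconnected block of [Q] makes the product vanish; if all blocks are connected,
   [feasible_extend] is available and the sum over [S] is 0. *)
have [/forall_inP cQ|] := boolP [forall B in Q, connected_in e B]; last first.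
  rewrite negb_forall_in => /exists_inP[B BQ ncB].
  by rewrite (bigD1 B) //= phi_disconnected // !mul0r.
have Qn0 : Q != set0.
  apply: contraTneq C1 => Q0; rewrite -leqNgt (cardsD1 v C) vC.
  have := cover_partition pQ; rewrite Q0 /cover big_set0 => <-.
  by rewrite cards0.
rewrite (sum_ordering_sum key_inj ee0 hh_ee _ Qn0) ?mulr0 // => S X SQ.
exact: feasible_extend cC vC vmin pQ cQ SQ.
Qed.

End ConnectedRecursion.

From mathcomp Require Import all_order finmap.
From mathcomp Require Import boolp classical_sets functions cardinality fsbigop.
From mathcomp Require Import monalg.

Import Order.TTheory Num.Theory.

(** * The ring of power series *)

Lemma wcomp_le_refl nu : wcomp_le nu nu.
Proof. by move=> i. Qed.

Lemma wcomp_le_trans mu nu rho : wcomp_le nu mu -> wcomp_le mu rho -> wcomp_le nu rho.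
Proof. by move=> h1 h2 i; apply: leq_trans (h1 i) (h2 i). Qed.

Lemma finite_lower nu : finite_set [set mu | wcomp_le mu nu]%classic.
Proof.
have [n hn] := wcomp_bound nu.
apply: (@finite_inj_fin _ _ _ (fun mu => wcomp_code mu n)) => mu rho.
rewrite !inE /= => /hn h1 /hn h2; exact: wcomp_code_inj.
Qed.

Definition lower (nu : wcomp) : {fset wcomp} := fset_set [set mu | wcomp_le mu nu]%classic.

Lemma lowerP nu mu : reflect (wcomp_le mu nu) (mu \in lower nu).
Proof.
rewrite /lower in_fset_set; last exact: finite_lower.
by apply: (iffP idP); rewrite in_setE.
Qed.

Lemma wcomp_divK (nu mu : wcomp) : wcomp_le mu nu -> mmul mu (divcm nu mu) = nu.
Proof.
by move=> h; apply/eqP/cmP => i; rewrite cmM divcmE subnKC.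
Qed.

Lemma wcomp_mulI (mu : wcomp) : injective (mmul mu : wcomp -> wcomp).
Proof.
move=> x y /eqP/cmP h; apply/eqP/cmP => i.
by have := h i; rewrite !cmM => /addnI.
Qed.

Lemma wcomp_le_mull (mu rho : wcomp) : wcomp_le mu (mmul mu rho).
Proof. by move=> i; rewrite cmM leq_addr. Qed.

Lemma wcomp_le_mulr (mu rho : wcomp) : wcomp_le rho (mmul mu rho).
Proof. by move=> i; rewrite cmM leq_addl. Qed.

Lemma series_mulE f g nu :
  series_mul f g nu = \sum_(mu <- lower nu) f mu * g (divcm nu mu).
Proof.
rewrite /series_mul (fsbigE [seq (mu, divcm nu mu) | mu <- lower nu]) /=.
- rewrite big_map big_seq_cond [RHS]big_seq_cond; apply: eq_bigl => mu.
  by case: lowerP => //= h; rewrite mem_set //; apply: wcomp_divK.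
- by rewrite map_inj_uniq ?fset_uniq // => x y [].
- by move=> _ /= /mapP[mu /lowerP h ->]; apply: wcomp_divK.
- move=> [mu rho] /= h /negP[]; apply/mapP; exists mu.
    by apply/lowerP; rewrite -h; apply: wcomp_le_mull.
  congr pair; apply: (@wcomp_mulI mu); rewrite wcomp_divK // -h.
  exact: wcomp_le_mull.
Qed.

(** A coefficient of a product involves only finitely many coefficients of the factors, so it can be
    computed with polynomials that agree with the series below [nu]. In this way associativity,
    commutativity and the unit law are inherited from polynomials. *)
Lemma series_mul_malg (p q : {malg int[{cmonom nat}]}) f g nu :
  (forall mu, wcomp_le mu nu -> p@_mu = f mu) ->
  (forall mu, wcomp_le mu nu -> q@_mu = g mu) ->
  (p * q)@_nu = series_mul f g nu.
Proof.
move=> hp hq; rewrite series_mulE.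
pose D : {fset {cmonom nat}} := lower nu.
rewrite (@mcoeffMlw _ _ (msupp p `|` D)%fset (msupp q `|` D)%fset);
  rewrite ?fsubsetUl //.
rewrite (big_fsetID _ (mem D)) /= [X in _ + X]big1_fset ?addr0; last first.
  move=> mu; rewrite !inE => /andP[_ nD] _; apply: big1 => rho _.
  case: eqP => // h; case/negP: nD; apply/lowerP; rewrite -h; exact: wcomp_le_mull.
have -> : [fset x in (msupp p `|` D)%fset | x \in D]%fset = D.
  by apply/fsetP => x; rewrite !inE /=; case: (x \in D); rewrite ?orbT ?andbF.
rewrite big_seq [RHS]big_seq; apply: eq_bigr => mu /lowerP hmu.
rewrite (big_fsetD1 (divcm nu mu)) /=; last first.
  rewrite inE; apply/orP; right; apply/lowerP; rewrite -{2}(wcomp_divK hmu).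
  exact: wcomp_le_mulr.
rewrite [X in _ + X]big1_fset ?addr0.
  rewrite (wcomp_divK hmu) eqxx mulr1n hp // hq //.
  by rewrite -{2}(wcomp_divK hmu); apply: wcomp_le_mulr.
move=> rho; rewrite in_fsetD1 => /andP[/eqP nrho _] _; case: eqP => // h; case: nrho.
by apply: (@wcomp_mulI mu); rewrite (wcomp_divK hmu).
Qed.

Definition trunc (nu : wcomp) (f : series) : {malg int[{cmonom nat}]} :=
  [malg mu in lower nu => f mu].

Lemma truncE nu f mu : wcomp_le mu nu -> (trunc nu f)@_mu = f mu.
Proof. by move=> /lowerP h; rewrite /trunc mcoeffE h. Qed.

Lemma trunc_mul nu f g mu : wcomp_le mu nu ->
  (trunc nu f * trunc nu g)@_mu = series_mul f g mu.
Proof.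
by move=> h; apply: series_mul_malg => rho hr; apply: truncE; apply: wcomp_le_trans h.
Qed.

(* An alias, because functions already carry the pointwise product. *)
Definition ser : Type := series.
HB.instance Definition _ := gen_eqMixin ser.
HB.instance Definition _ := gen_choiceMixin ser.

Definition ser_add (f g : ser) : ser := fun nu => f nu + g nu.
Definition ser_opp (f : ser) : ser := fun nu => - f nu.
Definition ser_zero : ser := fun nu => 0.

Lemma ser_addA : associative ser_add.
Proof. by move=> f g h; apply/funext => nu; apply: addrA. Qed.
Lemma ser_addC : commutative ser_add.
Proof. by move=> f g; apply/funext => nu; apply: addrC. Qed.
Lemma ser_add0 : left_id ser_zero ser_add.
Proof. by move=> f; apply/funext => nu; apply: add0r. Qed.
Lemma ser_addN : left_inverse ser_zero ser_opp ser_add.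
Proof. by move=> f; apply/funext => nu; apply: addNr. Qed.
HB.instance Definition _ := GRing.isZmodule.Build ser ser_addA ser_addC ser_add0 ser_addN.

Lemma ser_mulA : associative (series_mul : ser -> ser -> ser).
Proof.
move=> f g h; apply/funext => nu.
rewrite -(@series_mul_malg (trunc nu f) (trunc nu g * trunc nu h)).
- rewrite mulrA; apply: series_mul_malg => mu hmu; first exact: trunc_mul.
  exact: truncE.
- by move=> mu; apply: truncE.
- by move=> mu; apply: trunc_mul.
Qed.

Lemma ser_mulC : commutative (series_mul : ser -> ser -> ser).
Proof.
move=> f g; apply/funext => nu.
by rewrite -!(trunc_mul _ _ (wcomp_le_refl nu)) mulrC.
Qed.

Lemma ser_mul1 : left_id (series_one : ser) (series_mul : ser -> ser -> ser).
Proof.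
move=> f; apply/funext => nu.
rewrite -(@series_mul_malg 1 (trunc nu f)) ?mul1r ?(truncE _ (wcomp_le_refl nu)) //.
- by move=> mu _; rewrite mcoeff1.
- by move=> mu; apply: truncE.
Qed.

Lemma ser_mulDl : left_distributive (series_mul : ser -> ser -> ser) +%R.
Proof.
move=> f g h; apply/funext => nu.
transitivity (series_mul f h nu + series_mul g h nu); last by [].
rewrite !series_mulE -big_split /=.
by apply: eq_bigr => mu _; rewrite -mulrDl.
Qed.

Lemma ser_one_neq0 : (series_one : ser) != 0.
Proof.
apply/eqP => /(congr1 (fun f : ser => f mone)).
by rewrite /series_one eqxx.
Qed.

HB.instance Definition _ :=
  GRing.Zmodule_isComNzRing.Build ser ser_mulA ser_mulC ser_mul1 ser_mulDl ser_one_neq0.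

Definition scoef (nu : wcomp) (f : ser) : int := f nu.
Lemma scoef_is_zmod nu : zmod_morphism (scoef nu).
Proof. by move=> f g. Qed.
HB.instance Definition _ nu := GRing.isZmodMorphism.Build ser int (scoef nu) (scoef_is_zmod nu).

Lemma scoefM nu (f g : ser) : scoef nu (f * g) =
  \sum_(mu <- lower nu) scoef mu f * scoef (divcm nu mu) g.
Proof. exact: series_mulE. Qed.
Lemma scoef1 nu : scoef nu 1 = (nu == mone)%:R. Proof. by []. Qed.

(** * Elementary and complete homogeneous series *)

Definition ser_e (k : nat) : ser := elem_sym k.
Definition ser_h (k : nat) : ser := fun nu => (mdeg nu == k)%:R.

Definition square_free (nu : wcomp) : bool := all (fun i => nu i <= 1)%N (finsupp nu).

Lemma square_freeP (nu : wcomp) : reflect (forall i, nu i <= 1)%N (square_free nu).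
Proof.
apply: (iffP allP) => [h i|h i _]; last exact: h.
by case: (boolP (i \in finsupp nu)) => [/h//|h']; rewrite fsfun_dflt.
Qed.

Lemma scoef_e nu k : scoef nu (ser_e k) = ((mdeg nu == k) && square_free nu)%:R.
Proof. by []. Qed.

Lemma scoef_h nu k : scoef nu (ser_h k) = (mdeg nu == k)%:R.
Proof. by []. Qed.

Lemma serP (f g : ser) : (forall nu, scoef nu f = scoef nu g) -> f = g.
Proof. by move=> h; apply/funext. Qed.

Lemma mdeg_div (nu mu : wcomp) : wcomp_le mu nu ->
  mdeg nu = (mdeg mu + mdeg (divcm nu mu))%N.
Proof. by move=> h; rewrite -mdegM wcomp_divK. Qed.

Definition homogeneous d (f : ser) := forall nu, mdeg nu != d -> scoef nu f = 0.

Lemma homogeneous_e k : homogeneous k (ser_e k).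
Proof. by move=> nu /negbTE h; rewrite scoef_e h. Qed.

Lemma homogeneous_h k : homogeneous k (ser_h k).
Proof. by move=> nu /negbTE h; rewrite scoef_h h. Qed.

Lemma homogeneous1 : homogeneous 0 1.
Proof. by move=> nu; rewrite mdeg_eq0 scoef1 => /negbTE->. Qed.

Lemma homogeneousM d1 d2 f g : homogeneous d1 f -> homogeneous d2 g ->
  homogeneous (d1 + d2) (f * g).
Proof.
move=> hf hg nu hnu; rewrite scoefM big_seq big1 // => mu /lowerP le.
case: (eqVneq (mdeg mu) d1) => [e1|/hf->]; last by rewrite mul0r.
rewrite hg ?mulr0 //; apply: contraNneq hnu => e2.
by rewrite (mdeg_div le) e1 e2.
Qed.

Lemma homogeneous_sum (I : Type) (r : seq I) (P : pred I) F d :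
  (forall i, P i -> homogeneous d (F i)) -> homogeneous d (\sum_(i <- r | P i) F i).
Proof.
by move=> h nu hnu; rewrite raddf_sum big1 // => i /h; apply.
Qed.

Lemma homogeneous_prod (I : Type) (r : seq I) (P : pred I) F d :
  (forall i, P i -> homogeneous (d i) (F i)) ->
  homogeneous (\sum_(i <- r | P i) d i)%N (\prod_(i <- r | P i) F i).
Proof.
move=> h; apply: (big_rec2 (fun d f => homogeneous d f)); first exact: homogeneous1.
by move=> i d' f Pi; apply: homogeneousM; apply: h.
Qed.

Lemma homogeneous_sign d b f : homogeneous d f -> homogeneous d ((-1) ^+ b * f).
Proof.
move=> h nu hnu; rewrite -signr_odd.
by case: (odd b); rewrite ?expr1 ?expr0 ?mul1r ?mulN1r ?raddfN /= h // oppr0.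
Qed.

Lemma scoef_sign nu b (f : ser) : scoef nu ((-1) ^+ b * f) = (-1) ^+ b * scoef nu f.
Proof.
rewrite -[in LHS]signr_odd -[in RHS]signr_odd.
by case: (odd b); rewrite ?expr1 ?expr0 ?mul1r ?mulN1r ?raddfN.
Qed.

Section Toggle.
Variables (nu : wcomp) (j : nat).
Hypothesis nuj : (0 < nu j)%N.

(* A sign-reversing involution, which exchanges the exponents 0 and 1 of x_j in
   the square-free monomial x^(nu - mu). *)
Definition toggle (mu : wcomp) : wcomp :=
  if mu j == nu j then divcm mu (ucm j)
  else if (mu j).+1 == nu j then mmul mu (ucm j) else mu.

Lemma toggleK : involutive toggle.
Proof.
have [m ej] : exists m, nu j = m.+1 by exists (nu j).-1; rewrite prednK.
move=> mu; apply/eqP/cmP => i; rewrite /toggle.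
case: (eqVneq (mu j) (nu j)) => [e1|n1].
  rewrite divcmE cmU eqxx e1 ej subn1 /= eqn_leq ltnn andbF eqxx.
  by rewrite cmM divcmE cmU; case: eqP => [<-|_]; rewrite ?e1 ?ej ?subn0 ?addn0 // subnK.
case: (eqVneq (mu j).+1 (nu j)) => [e2|n2].
  by rewrite cmM cmU eqxx addn1 e2 eqxx divcmE cmM cmU addnK.
by rewrite (negbTE n1) (negbTE n2).
Qed.

Lemma toggle_le mu : wcomp_le mu nu -> wcomp_le (toggle mu) nu.
Proof.
move=> le i; rewrite /toggle; case: eqP => [e1|n1].
  by rewrite divcmE (leq_trans (leq_subr _ _)).
case: eqP => // e2; rewrite cmM cmU; case: eqP => [<-|_]; last by rewrite addn0.
by rewrite addn1 e2.
Qed.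

(** For [mu] below [nu], this is the contribution of [mu] to the coefficient of x^nu in the sum of
    the (-1)^i h_i e_(n-i), where n is the degree of [nu]. *)
Definition toggle_summand (mu : wcomp) : int :=
  (-1) ^+ mdeg mu * (square_free (divcm nu mu))%:R.

Lemma toggle_square_free (mu : wcomp) : mu j = nu j ->
  square_free (divcm nu (divcm mu (ucm j))) = square_free (divcm nu mu).
Proof.
move=> e1; apply/square_freeP/square_freeP => h i; have := h i; rewrite !divcmE cmU.
  by case: eqP => [<-|_]; rewrite ?e1 ?subnn // subn0.
by case: eqP => [<-|_]; rewrite ?subn0 // e1 subKn.
Qed.

Lemma toggleN mu : wcomp_le mu nu -> toggle_summand (toggle mu) = - toggle_summand mu.
Proof.
move=> le; rewrite /toggle_summand /toggle; case: (eqVneq (mu j) (nu j)) => [e1|n1].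
  rewrite toggle_square_free // -mulNr; congr (_ * _).
  have {2}-> : mu = mmul (ucm j) (divcm mu (ucm j)).
    rewrite wcomp_divK // => i; rewrite cmU; case: eqP => // <-; by rewrite e1.
  by rewrite mdegM mdegU exprS mulN1r opprK.
case: (eqVneq (mu j).+1 (nu j)) => [e2|n2].
  rewrite mdegM mdegU exprD expr1 mulrN1 -mulNr; congr (_ * _%:R).
  rewrite -(@toggle_square_free (mmul mu (ucm j))); last by rewrite cmM cmU eqxx addn1.
  congr (square_free (divcm nu _)); apply/eqP/cmP => i.
  by rewrite divcmE cmM addnK.
(* Here [nu j - mu j] is at least 2, so the summand is 0. *)
have -> : square_free (divcm nu mu) = false.
  apply/negbTE/negP => /square_freeP/(_ j); rewrite divcmE leqNgt => /negP; apply.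
  have := le j; rewrite leq_eqVlt (negbTE n1) /= leq_eqVlt (negbTE n2) /=.
  by rewrite ltn_subRL addn1.
by rewrite mulr0 oppr0.
Qed.

(** The involution permutes the divisors of x^nu and negates every summand, so the sum equals its
    own opposite. *)
Lemma sum_toggle : \sum_(mu <- lower nu) toggle_summand mu = 0.
Proof.
set S := LHS; suff : S = - S.
  by move/eqP; rewrite -subr_eq0 opprK -mulr2n mulrn_eq0 /= => /eqP.
rewrite {1}/S -sumrN.
have pm : perm_eq (map toggle (lower nu)) (lower nu).
  apply: uniq_perm; first by rewrite map_inj_uniq ?fset_uniq //; apply: inv_inj toggleK.
    exact: fset_uniq.
  move=> mu; apply/mapP/idP => [[rho /lowerP h ->]|/lowerP h].
    by apply/lowerP; apply: toggle_le.
  by exists (toggle mu); rewrite ?toggleK //; apply/lowerP; apply: toggle_le.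
rewrite -(perm_big _ pm) /= big_map big_seq [RHS]big_seq.
by apply: eq_bigr => mu /lowerP; apply: toggleN.
Qed.

End Toggle.

(** Coefficients in degrees other than [n] vanish by homogeneity. In degree [n], each divisor [mu]
    of x^nu occurs only for the index equal to its degree, and [sum_toggle] applies. *)
Lemma sum_h_e n : (0 < n)%N ->
  \sum_(i < n.+1) (-1) ^+ i * ser_h i * ser_e (n - i) = 0.
Proof.
move=> n0; apply: serP => nu; rewrite raddf0.
case: (eqVneq (mdeg nu) n) => [en|nn]; last first.
  apply: (@homogeneous_sum _ _ _ _ n) nn => i _.
  rewrite -mulrA; apply: homogeneous_sign.
  have {1}-> : n = (i + (n - i))%N by rewrite subnKC // -ltnS.
  apply: homogeneousM; [exact: homogeneous_h|exact: homogeneous_e].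
have [j j0] : exists j, (0 < nu j)%N.
  case: (pselect (exists j, 0 < nu j)%N) => // h.
  move: n0; rewrite -en mdegE big1 // => i _.
  by apply/eqP; rewrite -leqn0 leqNgt; apply/negP => h'; apply: h; exists i.
rewrite -(sum_toggle j0) raddf_sum /=.
under eq_bigr => i _ do rewrite -mulrA scoef_sign scoefM mulr_sumr.
rewrite exchange_big /= big_seq [RHS]big_seq; apply: eq_bigr => mu /lowerP le.
have lt : (mdeg mu < n.+1)%N by rewrite ltnS -en (mdeg_div le) leq_addr.
rewrite (bigD1 (Ordinal lt)) //= big1 ?addr0; last first.
  move=> i ni; rewrite scoef_h; case: eqP => [h|]; rewrite ?mul0r ?mulr0 //.
  by case/eqP: ni; apply/val_inj.
rewrite scoef_h eqxx mul1r scoef_e -en (mdeg_div le) addKn eqxx /=.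
by [].
Qed.

(** * e-positivity *)

Definition ser_e_seq (l : seq nat) : ser := \prod_(k <- l) ser_e k.

(** A list of lists stands for a sum of products of elementary series, with multiplicities. The
    inner lists may be unsorted and contain 0, so that closure under sums and products reduces to
    concatenation. *)
Definition e_pos (d : nat) (f : ser) : Prop :=
  exists2 ls : seq (seq nat), all (fun l => sumn l == d) ls & f = \sum_(l <- ls) ser_e_seq l.

Lemma e_pos0 d : e_pos d 0.
Proof. by exists [::]; rewrite ?big_nil. Qed.

Lemma e_posD d f g : e_pos d f -> e_pos d g -> e_pos d (f + g).
Proof.
move=> [lf hf ->] [lg hg ->]; exists (lf ++ lg); first by rewrite all_cat hf.
by rewrite big_cat.
Qed.

Lemma e_pos1 : e_pos 0 1.
Proof. by exists [:: [::]]; rewrite // big_seq1 /ser_e_seq big_nil. Qed.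

Lemma e_posM d1 d2 f g : e_pos d1 f -> e_pos d2 g -> e_pos (d1 + d2) (f * g).
Proof.
move=> [lf hf ->] [lg hg ->]; exists [seq u ++ v | u <- lf, v <- lg].
  apply/allP => _ /allpairsP[[u v] /= [hu hv ->]].
  by rewrite sumn_cat (eqP (allP hf _ hu)) (eqP (allP hg _ hv)).
rewrite big_allpairs_dep mulr_suml; apply: eq_bigr => u _; rewrite mulr_sumr.
by apply: eq_bigr => v _; rewrite /ser_e_seq big_cat.
Qed.

Lemma e_pos_sum (I : Type) (r : seq I) (P : pred I) F d :
  (forall i, P i -> e_pos d (F i)) -> e_pos d (\sum_(i <- r | P i) F i).
Proof.
move=> h; apply: (big_ind (e_pos d)) => //; [exact: e_pos0|exact: e_posD].
Qed.

Lemma e_pos_prod (I : Type) (r : seq I) (P : pred I) F d :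
  (forall i, P i -> e_pos (d i) (F i)) ->
  e_pos (\sum_(i <- r | P i) d i)%N (\prod_(i <- r | P i) F i).
Proof.
move=> h; apply: (big_rec2 (fun d f => e_pos d f)); first exact: e_pos1.
by move=> i d' f Pi; apply: e_posM; apply: h.
Qed.

Lemma e_pos_homogeneous d f : e_pos d f -> homogeneous d f.
Proof.
move=> [ls h ->]; rewrite big_seq; apply: homogeneous_sum => l hl.
rewrite -(eqP (allP h _ hl)) sumnE; apply: homogeneous_prod => k _.
exact: homogeneous_e.
Qed.

Lemma ser_e0 : ser_e 0 = 1.
Proof.
apply: serP => nu; rewrite scoef_e scoef1 mdeg_eq0; case: eqP => //= ->.
by rewrite (_ : square_free _) //; apply/square_freeP => i; rewrite cm1.
Qed.

Definition part_of_seq (l : seq nat) : seq nat := sort geq [seq k <- l | k != 0%N].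

Lemma part_of_seqP l : is_part (part_of_seq l).
Proof.
rewrite /is_part sort_sorted; last by move=> x y; apply: leq_total.
by rewrite mem_sort mem_filter eqxx.
Qed.

Definition intpart_of_seq (l : seq nat) : intpart := exist is_part _ (part_of_seqP l).

Lemma elem_sym_intpart_of_seq l : elem_sym_part (intpart_of_seq l) = ser_e_seq l.
Proof.
transitivity (\prod_(k <- part_of_seq l) ser_e k); first by [].
rewrite (perm_big _ (permEl (perm_sort _ _))) big_filter /ser_e_seq.
by rewrite big_mkcond; apply: eq_bigr => -[|k] //= _; rewrite ser_e0.
Qed.

(** The coefficient of a partition is the number of lists that become this partition after sorting
    and dropping zeros. *)
Lemma e_pos_e_positive d f : e_pos d f -> e_positive f.
Proof.
move=> [ls _ ->]; pose S : {fset intpart} := [fset intpart_of_seq l | l in ls]%fset.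
pose m (lam : intpart) : int := (count (fun l => intpart_of_seq l == lam) ls)%:Z.
exists [fsfun lam in S => m lam]; split; last first.
  by move=> lam; rewrite fsfunE; case: ifP.
move=> nu; rewrite -[LHS]/(scoef nu _) raddf_sum /=.
rewrite (big_fset_incl _ (finsupp_sub _ _ _)) /=; last first.
  by move=> lam _; rewrite memNfinsupp => /eqP->; rewrite mul0r.
transitivity (\sum_(l <- ls) \sum_(lam <- S)
  (intpart_of_seq l == lam)%:R * elem_sym_part lam nu).
  rewrite big_seq [RHS]big_seq; apply: eq_bigr => l hl.
  rewrite (big_fsetD1 (intpart_of_seq l)) /=; last by apply/imfsetP; exists l.
  rewrite eqxx mul1r big1_fset ?addr0 ?elem_sym_intpart_of_seq // => lam.
  by rewrite in_fsetD1 eq_sym => /andP[/negbTE-> _] _; rewrite mul0r.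
rewrite exchange_big /= big_seq [RHS]big_seq; apply: eq_bigr => lam hlam.
rewrite fsfunE hlam -mulr_suml; congr (_ * _).
by rewrite /m -sum1_count -natz natr_sum [RHS]big_mkcond /=; apply: eq_bigr => l _; case: eqP.
Qed.

(** * Coefficients of finite products *)

Section ScoefProd.
Variables (I : finType) (F : I -> ser) (nu : wcomp).

Let agree (p : {malg int[{cmonom nat}]}) (f : ser) : Prop :=
  forall mu, wcomp_le mu nu -> p@_mu = scoef mu f.

Lemma agree_sum (f : ser) : agree (\sum_(m : lower nu) << scoef (val m) f *g val m >>) f.
Proof.
move=> mu /lowerP h; rewrite raddf_sum (bigD1 [` h]%fset) //= mcoeffUU big1 ?addr0 //.
move=> m nm; rewrite mcoeffU; case: eqP => [e|_]; last by rewrite mulr0n.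
by case/eqP: nm; apply/val_inj.
Qed.

(** The factors are cut down to finite sums of monomials below [nu]; by distributivity their product
    expands over the choices [w] of one monomial from each factor. *)
Lemma scoef_prod mu : wcomp_le mu nu -> scoef mu (\prod_i F i) =
  \sum_(w : {ffun I -> lower nu} | wcomp_sum xpredT (fun i => val (w i)) == mu)
    \prod_i scoef (val (w i)) (F i).
Proof.
move=> le; pose G i : {malg int[{cmonom nat}]} :=
  \sum_(m : lower nu) << scoef (val m) (F i) *g val m >>.
have <- : (\prod_i G i)@_mu = scoef mu (\prod_i F i).
  have : agree (\prod_i G i) (\prod_i F i).
    apply: (big_ind2 agree) => [rho _|p f q g hp hq rho hr|i _].
    - by rewrite mcoeff1.
    - by apply: series_mul_malg => sig hs; [apply: hp|apply: hq]; apply: wcomp_le_trans hr.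
    - exact: agree_sum.
  exact.
rewrite bigA_distr_bigA /= raddf_sum [RHS]big_mkcond /=; apply: eq_bigr => w _.
have -> : \prod_i (<< scoef (val (w i)) (F i) *g val (w i) >> : {malg int[{cmonom nat}]}) =
    << \prod_i scoef (val (w i)) (F i) *g wcomp_sum xpredT (fun i => val (w i)) >>.
  rewrite /wcomp_sum.
  apply: (big_rec3 (fun (x : {malg int[{cmonom nat}]}) y (z : wcomp) => x = << y *g z >>)) => //.
  by move=> i x y z _ ->; rewrite malgM_def fgmulUU.
by rewrite mcoeffU; case: eqP.
Qed.

End ScoefProd.

(** * Block series of chordal graphs *)

Lemma sum_card_pred (T : finType) (P : {set {set T}}) (D : {set T}) : finset.partition P D ->
  (\sum_(B in P) #|B|.-1 + #|P| = #|D|)%N.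
Proof.
move=> pP; rewrite (card_partition pP) -sum1_card -big_split /=.
apply: eq_bigr => B BP; rewrite addn1 prednK // card_gt0.
by case/partition_charP: pP => /(_ B BP)[].
Qed.

Lemma partition_card_gt0 (T : finType) (P : {set {set T}}) (D : {set T}) :
  finset.partition P D -> (0 < #|D|)%N -> (0 < #|P|)%N.
Proof.
move=> pP D0; rewrite card_gt0; apply: contraTneq D0 => P0.
by rewrite (card_partition pP) P0 big_set0.
Qed.

(* These properties determine [phi]: up to sign, it is the contribution of one
   block to the Moebius function of the bond poset. *)
Record block_series (T : finType) (e : rel T) (phi : {set T} -> ser) : Prop := {
  block_homogeneous : forall B : {set T}, homogeneous #|B|.-1 (phi B);
  block_single : forall v, phi [set v]%SET = 1;
  block_disconnected : forall B : {set T}, ~~ connected_in e B -> phi B = 0;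
  block_sum : forall C : {set T}, connected_in e C -> (1 < #|C|)%N ->
    \sum_(P | finset.partition P C)
      (-1) ^+ #|P|.-1 * ser_h #|P|.-1 * \prod_(B in P) phi B = 0 }.

Section ChordalBlockSeries.
Variables (T : finType) (e : rel T) (r : T -> nat).

Lemma e_pos_rooted_sum v (S : {set {set T}}) : e_pos #|S| (rooted_sum e r ser_e v S).
Proof.
rewrite /rooted_sum /ordering_sum big_seq_cond; apply: e_pos_sum => t.
case/andP => /perm_enumP[ut tS] _; exists [:: runs (key r) t]; last by rewrite big_seq1.
by rewrite /= andbT sumn_runs -(card_uniqP ut); apply/eqP/eq_card.
Qed.

Lemma e_pos_phi (C : {set T}) : e_pos #|C|.-1 (phi e r ser_e C).
Proof.
have [n] := ubnP #|C|; elim: n C => // n IH C; rewrite ltnS => Cn.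
case: (set_0Vmem C) => [->|[x xC]]; first by rewrite phi0; apply: e_pos0.
have [|v [rC vC _]] := @root_ex T r C; first by apply/finset.set0Pn; exists x.
have cC : #|C| = #|C :\ v|.+1 by rewrite (cardsD1 v C) vC.
rewrite (phiE _ _ rC) cC /=; apply: e_pos_sum => P pP.
(* The rooted sum has degree [#|P|] and each block degree [#|B|.-1], in total the size of
   [C :\ v]. *)
rewrite -(sum_card_pred pP) addnC; apply: e_posM; first exact: e_pos_rooted_sum.
apply: e_pos_prod => B BP; apply: IH; apply: leq_trans Cn.
by rewrite cC ltnS; apply: partition_card_le BP.
Qed.

End ChordalBlockSeries.

Lemma chordal_block_series (T : finType) (e : rel T) :
  symmetric e -> irreflexive e -> chordal e ->
  exists2 phi : {set T} -> ser, block_series e phi & forall B : {set T}, e_pos #|B|.-1 (phi B).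
Proof.
move=> e_sym e_irr e_chordal.
have [r r_inj r_nbr] := chordal_smaller_neighbor e_sym e_irr e_chordal.
exists (phi e r ser_e); last exact: e_pos_phi.
split.
- by move=> B; apply: e_pos_homogeneous; apply: e_pos_phi.
- by move=> v; apply: phi1.
- by move=> B; apply: phi_disconnected.
- by move=> C cC C1; apply: (phi_sum e_sym r_inj r_nbr ser_e0 sum_h_e).
Qed.

(** Let s be the sum of the [#|B|.-1], which is the degree of the product of the [phi B]. As
    [#|C|.-1] is s plus [#|P|.-1], multiplying by [ser_h #|P|.-1] adds up the coefficients of the
    product below [nu]. Up to sign, the claim is thus the coefficient of x^nu in [block_sum]. *)
Lemma block_lower_sum (T : finType) (e : rel T) phi (C : {set T}) nu :
  block_series e phi -> connected_in e C -> (1 < #|C|)%N -> mdeg nu = #|C|.-1 ->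
  \sum_(P | finset.partition P C) \sum_(mu <- lower nu)
    scoef mu (\prod_(B in P) ((-1) ^+ #|B|.-1 * phi B)) = 0.
Proof.
move=> phiP cC C1 dnu.
have := congr1 (scoef nu) (block_sum phiP cC C1); rewrite raddf0 raddf_sum /=.
move/(congr1 (fun x => (-1) ^+ #|C|.-1 * x)); rewrite mulr0 mulr_sumr => E.
rewrite -[RHS]E; apply: eq_bigr => P pP.
have sz := sum_card_pred pP; set s := (\sum_(B in P) _)%N in sz.
have P0 : (0 < #|P|)%N by apply: partition_card_gt0 pP _; apply: ltnW.
have Cs : #|C|.-1 = (s + #|P|.-1)%N by rewrite -sz -{1}(prednK P0) addnS.
(* The signs with exponents [#|C|.-1] and [#|P|.-1] combine to (-1)^s, the sign of the product over
   the blocks. *)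
rewrite -[X in scoef nu X]mulrA scoef_sign mulrA Cs exprD
  -[_ * _ * (-1) ^+ _]mulrA -expr2 sqrr_sign mulr1.
rewrite big_split /= -expr_sum -/s [ser_h _ * _]mulrC scoefM mulr_sumr.
have hF : homogeneous s (\prod_(B in P) phi B).
  by apply: homogeneous_prod => B _; apply: block_homogeneous phiP B.
rewrite big_seq [RHS]big_seq; apply: eq_bigr => mu /lowerP le.
rewrite scoef_sign; congr (_ * _).
case: (eqVneq (mdeg mu) s) => [dmu|/hF->]; last by rewrite mul0r.
by have := mdeg_div le; rewrite dnu Cs dmu => /addnI ->; rewrite scoef_h eqxx mulr1.
Qed.

(** * The Moebius function of the weighted bond poset *)

Section MobiusFormula.
Variables (T : finType) (e : rel T) (phi : {set T} -> ser).
Hypothesis phiP : block_series e phi.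
Implicit Types (A B C : {set T}) (P : {set {set T}}).

Definition signed_block (B : {set T}) : ser := (-1) ^+ #|B|.-1 * phi B.
Local Notation psi := signed_block.

Lemma homogeneous_signed_block B : homogeneous #|B|.-1 (psi B).
Proof. exact/homogeneous_sign/(block_homogeneous phiP). Qed.

(** Weights inside [C] are reset to zero, so that equality of these pairs means agreement outside
    [C]. *)
Definition outer_part C (p : wpart T) : {set {set T}} * {ffun {set T} -> wcomp} :=
  ([set B in blocks p | ~~ (B \subset C)]%SET,
   [ffun B : {set T} => if B \subset C then mone : wcomp else wt p B]).

Definition inner_blocks C (p : wpart T) : {set {set T}} := [set B in blocks p | B \subset C]%SET.

Definition inner_weight C (p : wpart T) : wcomp :=
  wcomp_sum (fun B => (B \in blocks p) && (B \subset C)) (wt p).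

Lemma outer_part_blocks C p q B : outer_part C p = outer_part C q -> ~~ (B \subset C) ->
  (B \in blocks p) = (B \in blocks q).
Proof.
by case=> /setP/(_ B) + _ nBC; rewrite !inE nBC !andbT.
Qed.

Lemma outer_part_wt C p q B : outer_part C p = outer_part C q -> ~~ (B \subset C) ->
  wt p B = wt q B.
Proof.
by case=> _ /ffunP/(_ B) + nBC; rewrite !ffunE (negbTE nBC).
Qed.

Lemma wt_inner_le C p B i : B \subset C -> (wt p B i <= inner_weight C p i)%N.
Proof.
move=> BC; rewrite wcomp_sumE; case: (boolP (B \in blocks p)) => Bp.
  by rewrite (bigD1 B) /= ?Bp // leq_addr.
by rewrite wt_out // cm1.
Qed.

(** * Sums over weighted partitions that vary only inside a given set *)

Section InnerSum.
Variables (C : {set T}) (z0 : wbond e) (nu : wcomp) (Q : pred wcomp).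
Hypothesis z0C : forall B, B \in blocks z0 -> B \subset C \/ [disjoint B & C].
Hypothesis Q_le : forall m, Q m -> wcomp_le m nu.

Let X : finType := ({set {set T}} * {ffun {set T} -> lower nu})%type.

Let mone_lower : mone \in lower nu.
Proof. by apply/lowerP => i; rewrite cm1. Qed.

Let code (z : wbond e) : X :=
  (inner_blocks C z,
   [ffun B : {set T} => insubd [` mone_lower]%fset (if B \subset C then wt z B else mone)]).

(** This describes the image under [code] of the partitions that satisfy [inside]. *)
Let valid (x : X) : bool :=
  [&& finset.partition x.1 C, [forall B in x.1, connected_in e B],
      [forall B in x.1, mdeg (val (x.2 B)) == #|B|.-1],
      [forall B, (B \notin x.1) ==> (val (x.2 B) == mone)]
    & Q (wcomp_sum xpredT (fun B => val (x.2 B)))].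

Let inside (z : wbond e) : Prop :=
  outer_part C z = outer_part C z0 /\ Q (inner_weight C z).

Lemma code_wt z B : inside z ->
  val ((code z).2 B) = if B \subset C then wt z B else mone.
Proof.
move=> [_ /Q_le le]; rewrite ffunE val_insubd; case: (boolP (B \subset C)) => BC; last by rewrite if_same.
suff -> : wt z B \in lower nu by [].
by apply/lowerP => i; apply: leq_trans (le i); apply: wt_inner_le.
Qed.

Lemma inside_blocks z B : inside z -> B \in blocks z -> B \subset C \/ [disjoint B & C].
Proof.
move=> [oz _] Bz; case: (boolP (B \subset C)) => BC; first by left.
by right; move: Bz; rewrite (outer_part_blocks oz BC) => /z0C[|//]; rewrite (negbTE BC).
Qed.

Lemma inner_partition z : inside z -> finset.partition (inner_blocks C z) C.
Proof.
move=> zin; have /partition_charP[sub ex un] := blocks_partition z.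
apply/partition_charP; split.
- by move=> A; rewrite inE => /andP[/sub[An _] AC].
- move=> x xC; have [|A Az xA] := ex x; first by rewrite inE.
  exists A => //; rewrite inE Az /=; case: (inside_blocks zin Az) => // /pred0P/(_ x) /=.
  by rewrite xA xC.
- by move=> A B x; rewrite !inE => /andP[Az _] /andP[Bz _]; apply: un.
Qed.

Lemma code_weight z : inside z ->
  wcomp_sum xpredT (fun B => val ((code z).2 B)) = inner_weight C z.
Proof.
move=> zin; apply/eqP/cmP => i; rewrite !wcomp_sumE [RHS]big_mkcond /=.
apply: eq_bigr => B _; rewrite code_wt //.
case: (boolP (B \subset C)) => _; last by rewrite andbF cm1.
by rewrite andbT; case: ifPn => // /wt_out ->; rewrite cm1.
Qed.

Lemma code_valid z : inside z -> valid (code z).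
Proof.
move=> zin; have [_ Qz] := zin; apply/and5P; split.
- exact: inner_partition.
- apply/forall_inP => B; rewrite inE => /andP[Bz _].
  by have /forall_inP := wbondP z; apply.
- apply/forall_inP => B; rewrite inE => /andP[Bz BC]; rewrite code_wt // BC.
  by have /and3P[_ /forall_inP h _] := wpartP z; apply: h.
- apply/forallP => B; apply/implyP; rewrite inE code_wt //; case: (boolP (B \subset C)) => // BC.
  by rewrite andbT => /wt_out ->.
- by rewrite code_weight.
Qed.

Lemma code_inj : {in [pred z | `[< inside z >]] &, injective code}.
Proof.
move=> z z' /asboolP zin /asboolP zin' E.
have oz : outer_part C z = outer_part C z' by rewrite zin.1 zin'.1.
have bE : blocks z = blocks z'.
  apply/setP => B; case: (boolP (B \subset C)) => BC; last exact: outer_part_blocks oz BC.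
  by have /setP/(_ B) := congr1 fst E; rewrite !inE BC !andbT.
apply/val_inj/wpart_eq => // B _ i; case: (boolP (B \subset C)) => BC.
  by have := congr1 (fun x : X => val (x.2 B)) E; rewrite !code_wt // BC => ->.
by rewrite (outer_part_wt oz BC).
Qed.

Section Decode.
Variable x : X.
Hypothesis vx : valid x.

Let dblocks : {set {set T}} := x.1 :|: (outer_part C z0).1.
Let dwt : {ffun {set T} -> wcomp} :=
  [ffun B : {set T} => if B \subset C then val (x.2 B) : wcomp else wt z0 B].

Let x1C B : B \in x.1 -> B \subset C.
Proof. by case/and5P: vx => /partition_charP[sub _ _] _ _ _ _ /sub[]. Qed.

Let outerC B : B \in (outer_part C z0).1 ->
  [/\ B \in blocks z0, ~~ (B \subset C) & [disjoint B & C]].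
Proof.
by rewrite inE => /andP[Bz nBC]; split=> //; case: (z0C Bz) => // h; rewrite h in nBC.
Qed.

Lemma decode_is_wpart : is_wpart (dblocks, dwt).
Proof.
have /and3P[_ /forall_inP m0 /forallP o0] := wpartP z0.
have /partition_charP[sub0 ex0 un0] := blocks_partition z0.
case/and5P: vx => /partition_charP[subx exx unx] _ /forall_inP mx /forallP ox _.
apply/and3P; split => /=.
- apply/partition_charP; split.
  + move=> A /setUP[/subx[An _]|/outerC[/sub0[An _] _ _]]; split=> //; exact: finset.subsetT.
  + move=> y _; case: (boolP (y \in C)) => yC.
      by have [A Ax yA] := exx y yC; exists A; rewrite // inE Ax.
    have [|A Az yA] := ex0 y; first by rewrite inE.
    exists A => //; rewrite !inE Az /=; apply/orP; right.
    by apply: contra yC => /fintype.subsetP; apply.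
  + have dis A B y : A \in x.1 -> B \in (outer_part C z0).1 -> y \in A -> y \in B -> False.
      move=> /x1C/fintype.subsetP AC /outerC[_ _ /pred0P/(_ y)] /= + /AC yC yB.
      by rewrite yB yC.
    move=> A B y /setUP[Ax|Ao] /setUP[Bx|Bo] yA yB; first exact: unx yA yB.
    * by case: (dis A B y).
    * by case: (dis B A y).
    * by have [Az _ _] := outerC Ao; have [Bz _ _] := outerC Bo; apply: un0 yA yB.
- apply/forall_inP => B /setUP[Bx|Bo]; rewrite ffunE; first by rewrite x1C // mx.
  by have [Bz nBC _] := outerC Bo; rewrite (negbTE nBC) m0.
- apply/forallP => B; apply/implyP; rewrite ffunE !inE negb_or => /andP[nBx].
  case: (boolP (B \subset C)) => BC /=; first by move=> _; have := ox B; rewrite nBx.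
  by rewrite andbT => nBz; apply/eqP/wt_out.
Qed.

Lemma decode_connected : [forall B in blocks (WPart decode_is_wpart), connected_in e B].
Proof.
case/and5P: vx => _ /forall_inP cx _ _ _.
apply/forall_inP => B /setUP[/cx//|/outerC[Bz _ _]].
by have /forall_inP := wbondP z0; apply.
Qed.

Definition decode : wbond e := WBond decode_connected.

Lemma blocks_decode B : (B \in blocks decode) = (B \in dblocks). Proof. by []. Qed.
Lemma wt_decode B : wt decode B = if B \subset C then val (x.2 B) else wt z0 B.
Proof. by rewrite /wt /= ffunE. Qed.

Lemma inner_decode B : (B \in blocks decode) && (B \subset C) = (B \in x.1).
Proof.
rewrite blocks_decode !inE; case: (boolP (B \subset C)) => BC; last first.
  by rewrite andbF; apply/esym/negbTE; apply: contra BC => /x1C.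
by rewrite !andbF orbF andbT.
Qed.

Lemma decode_inside : inside decode.
Proof.
split.
  congr pair.
    apply/setP => B; rewrite !inE; case: (boolP (B \subset C)) => BC; rewrite ?andbF // !andbT.
    by rewrite (_ : (B \in x.1) = false) //; apply/negbTE; apply: contra BC; apply: x1C.
  by apply/ffunP => B; rewrite !ffunE wt_decode; case: (B \subset C).
case/and5P: (vx) => _ _ _ /forallP ox; congr (is_true (Q _)); apply/eqP/cmP => i.
rewrite !wcomp_sumE [RHS]big_mkcond /=; apply: eq_bigr => B _.
rewrite inner_decode wt_decode; case: (boolP (B \in x.1)) => [/x1C->//|nB].
by have := ox B; rewrite nB /= => /eqP ->; rewrite cm1.
Qed.

Lemma decodeK : code decode = x.
Proof.
have din := decode_inside.
rewrite [RHS]surjective_pairing; congr pair.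
  by apply/setP => B; rewrite inE inner_decode.
apply/ffunP => B; apply/val_inj; rewrite (code_wt B din) wt_decode.
case: (boolP (B \subset C)) => // nBC; apply/esym/eqP.
case/and5P: vx => _ _ _ /forallP/(_ B)/implyP h _; apply: h.
by apply: contra nBC => /x1C.
Qed.

End Decode.

(* A weighted partition that agrees with [z0] outside [C] amounts to a weighted
   partition of [C]; this is applied both to a block [C] of a larger weighted
   partition and to [C = V]. *)
Lemma inner_sum (Z : {fset wbond e}) :
  (forall z, z \in Z <-> outer_part C z = outer_part C z0 /\ Q (inner_weight C z)) ->
  \sum_(z <- Z) \prod_(B in inner_blocks C z) scoef (wt z B) (psi B) =
  \sum_(P | finset.partition P C) \sum_(mu <- lower nu | Q mu)
    scoef mu (\prod_(B in P) psi B).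
Proof.
move=> ZP.
pose F (x : X) := \prod_(B in x.1) scoef (val (x.2 B)) (psi B).
have pm : perm_eq (map code Z) [seq x <- enum X | valid x].
  apply: uniq_perm.
  - rewrite map_inj_in_uniq ?fset_uniq // => z z' /ZP zin /ZP zin'.
    by apply: code_inj; apply/asboolP.
  - by rewrite filter_uniq // enum_uniq.
  - move=> x; rewrite mem_filter mem_enum inE andbT; apply/mapP/idP => [[z /ZP zin ->]|vx].
      exact: code_valid.
    by exists (decode vx); rewrite ?decodeK //; apply/ZP/decode_inside.
transitivity (\sum_(x <- map code Z) F x).
  rewrite big_map big_seq [RHS]big_seq; apply: eq_bigr => z /ZP zin.
  apply: eq_bigr => B; rewrite inE => /andP[_ BC].
  by rewrite code_wt // BC.
rewrite (perm_big _ pm) big_filter big_enum_cond /=.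
transitivity (\sum_(P | finset.partition P C)
  \sum_(w : {ffun {set T} -> lower nu} | Q (wcomp_sum xpredT (fun B => val (w B))))
    \prod_B scoef (val (w B)) (if B \in P then psi B else 1)).
  rewrite pair_big_dep /= big_mkcond [RHS]big_mkcond; apply: eq_bigr => -[P w] _ /=.
  case: ifPn => [/and5P[/= pP cP mP oP QP]|]; rewrite ?pP ?QP /=.
    rewrite /F /= big_mkcond; apply: eq_bigr => B _; case: ifPn => // nB.
    by have /forallP/(_ B) := oP; rewrite nB /= => /eqP->; rewrite scoef1 eqxx.
  (* The remaining pairs contribute 0: [psi B] vanishes for disconnected [B] and is homogeneous of
     degree [#|B|.-1], and the factor 1 off [P] forces weight zero there. *)
  case: ifP => // /andP[pP QP]; rewrite /valid /= pP QP /= andbT.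
  rewrite !negb_and => /or3P[].
  - rewrite negb_forall_in => /exists_inP[B BP nc]; rewrite (bigD1 B) //= BP.
    by rewrite /psi (block_disconnected phiP) // mulr0 raddf0 mul0r.
  - rewrite negb_forall_in => /exists_inP[B BP nm]; rewrite (bigD1 B) //= BP.
    by rewrite (homogeneous_signed_block nm) mul0r.
  - rewrite negb_forall => /existsP[B]; rewrite negb_imply => /andP[BP nm].
    by rewrite (bigD1 B) //= (negbTE BP) scoef1 (negbTE nm) mul0r.
apply: eq_bigr => P _; rewrite big_mkcond /=.
(* The weight functions are grouped by their total weight [mu], to match the expansion in
   [scoef_prod]. *)
rewrite (eq_bigr (fun w : {ffun {set T} -> lower nu} => \sum_(mu <- lower nu | Q mu)
    if wcomp_sum xpredT (fun B => val (w B)) == mu then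
      \prod_B scoef (val (w B)) (if B \in P then psi B else 1) else 0)); last first.
  move=> w _; case: ifP => Qw.
    rewrite [RHS]big_mkcond (big_fsetD1 (wcomp_sum xpredT (fun B => val (w B)))) /=.
      rewrite Qw eqxx big1_fset ?addr0 // => mu; rewrite in_fsetD1 eq_sym.
      by case/andP => /negbTE-> _ _; rewrite if_same.
    exact/lowerP/Q_le.
  by rewrite big1 // => mu Qmu; case: eqP => // h; rewrite h Qmu in Qw.
rewrite exchange_big /= [LHS]big_seq_cond [RHS]big_seq_cond.
apply: eq_bigr => mu /andP[/lowerP le _].
by rewrite -big_mkcond [in RHS]big_mkcond (scoef_prod _ le).
Qed.

End InnerSum.

(** * The Moebius function as a product over blocks *)

Definition block_product (z : wpart T) : int := \prod_(B in blocks z) scoef (wt z B) (psi B).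

Lemma block_product_split C z : block_product z =
  (\prod_(B in (outer_part C z).1) scoef ((outer_part C z).2 B) (psi B)) *
  \prod_(B in inner_blocks C z) scoef (wt z B) (psi B).
Proof.
rewrite /block_product (bigID (fun B : {set T} => B \subset C)) /= mulrC; congr (_ * _).
  apply: eq_big => [B|B /andP[_ nBC]]; first by rewrite inE.
  by rewrite ffunE (negbTE nBC).
by apply: eq_bigl => B; rewrite inE.
Qed.

(** A singleton block has a weight of degree 0, so the partition into singletons carries only one
    weight function. *)
Lemma wbond0_eq (y : wbond e) : (forall C, C \in blocks y -> (#|C| <= 1)%N) -> y = wbond0 e.
Proof.
move=> y1; have /partition_charP[sub ex un] := blocks_partition y.
have bs B : B \in blocks y -> exists x, B = [set x]%SET.
  move=> By; apply/cards1P; rewrite eqn_leq y1 // card_gt0.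
  by case: (sub B By).
apply/val_inj/wpart_eq.
  apply/setP => B; apply/idP/imsetP => [/bs[x ->]|[x _ ->]]; first by exists x.
  have [|A Ay xA] := ex x; first by rewrite inE.
  by have [z zE] := bs A Ay; move: xA Ay; rewrite zE inE => /eqP->.
move=> B By i; have /and3P[_ /forall_inP/(_ B By) + _] := wpartP y.
have b1 : #|B| = 1%N by have [x ->] := bs B By; rewrite cards1.
rewrite b1 mdeg_eq0 => /eqP h.
by rewrite /wt /= ffunE; have -> : (val y).2 B = mone := h.
Qed.

Lemma block_product0 : block_product (wbond0 e) = 1.
Proof.
apply: big1 => B /imsetP[x _ ->].
by rewrite /wt /= ffunE /psi cards1 expr0 mul1r (block_single phiP) scoef1 eqxx.
Qed.

(** Some block [C] of [y] has at least two vertices. The elements below [y] are grouped by their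
    part outside [C]; in each group the outer factor is constant, and the sum of the inner factors
    is 0 by [block_lower_sum]. *)
Lemma block_product_sum (y : wbond e) : y != wbond0 e ->
  \sum_(z \in poset_itv (wbond0 e) y) block_product z = 0.
Proof.
move=> ny; have fin := @finite_wbond_itv T e (wbond0 e) y.
rewrite fsbig_finite //; set A := fset_set _.
have AP z : (z \in A) = (z <= y)%O.
  by rewrite /A in_fset_set //; apply/idP/idP; rewrite inE /poset_itv /= wbond0_le.
have [C Cy C1] : exists2 C, C \in blocks y & (1 < #|C|)%N.
  apply: contrapT => h; case/eqP: ny; apply: wbond0_eq => C Cy; rewrite leqNgt.
  by apply/negP => C1; apply: h; exists C.
have dC : mdeg (wt y C) = #|C|.-1.
  by have /and3P[_ /forall_inP/(_ C Cy)/eqP] := wpartP y.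
have cC : connected_in e C by have /forall_inP := wbondP y; apply.
rewrite (partition_big_imfset _ (fun z : wbond e => outer_part C z)) /=.
rewrite big_seq big1 // => _ /imfsetP[z0 /= z0A ->].
have /asboolP[z0y z0w] : (val z0 <= val y)%O by rewrite AP in z0A.
have /partition_charP[_ _ un] := blocks_partition y.
have blockC (z : wbond e) B : (val z <= val y)%O ->
    B \in blocks z -> B \subset C \/ [disjoint B & C].
  move=> /asboolP[zy _] /zy[D Dy BD]; have [<-|nDC] := eqVneq D C; first by left.
  right; apply/pred0P => x /=; apply/negP => /andP[xB xC]; case/eqP: nDC.
  by apply: un xC => //; apply: (fintype.subsetP BD).
pose Z := [fset z in A | outer_part C z == outer_part C z0]%fset.
(* Once the outer part is that of [z0], lying below [y] only requires that the total weight inside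
   [C] be at most that of [C] in [y]. *)
have ZP (z : wbond e) : z \in Z <-> outer_part C z = outer_part C z0 /\
    (inner_weight C z \in lower (wt y C)).
  rewrite !inE /= AP; split.
    move=> /andP[zy /eqP oz]; split => //; apply/lowerP.
    by have /asboolP[_ h] : (val z <= val y)%O := zy; apply: h.
  move=> [oz /lowerP wz]; rewrite oz eqxx andbT.
  change (val z <= val y)%O; apply/asboolP; split.
    move=> B Bz; case: (boolP (B \subset C)) => BC; first by exists C.
    by apply: z0y; rewrite -(outer_part_blocks oz BC).
  move=> B By; have [->|nBC] := eqVneq B C; first exact: wz.
  move=> i; apply: leq_trans (z0w B By i); rewrite !wcomp_sumE.
  rewrite big_mkcond [leqRHS]big_mkcond /=; apply: leq_sum => D _.
  case: (boolP (D \subset B)) => DB; rewrite ?andbF // !andbT.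
  case: (boolP (D \subset C)) => DC; last first.
    by rewrite (outer_part_blocks oz DC) (outer_part_wt oz DC).
  case: ifP => // Dz; have [x xD] := block_ex Dz; case/eqP: nBC.
  by apply: (un _ _ x) => //; [apply: (fintype.subsetP DB)|apply: (fintype.subsetP DC)].
rewrite (_ : \sum_(_ <- _ | _) _ = \sum_(z <- Z) block_product z); last first.
  by rewrite big_fset_condE.
pose c := \prod_(B in (outer_part C z0).1) scoef ((outer_part C z0).2 B) (psi B).
transitivity (c * \sum_(z <- Z) \prod_(B in inner_blocks C z) scoef (wt z B) (psi B)).
  rewrite mulr_sumr big_seq [RHS]big_seq; apply: eq_bigr => z /ZP[oz _].
  by rewrite (block_product_split C) oz.
rewrite (@inner_sum C z0 (wt y C) (mem (lower (wt y C)))) //.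
- apply: etrans (mulr0 c); congr (_ * _); apply: etrans (block_lower_sum phiP cC C1 dC).
  by apply: eq_bigr => P _; rewrite [RHS]big_seq.
- by move=> B; apply: blockC; rewrite AP in z0A.
- by move=> m /lowerP.
Qed.

(** Both sides are 1 at the minimum and sum to 0 over every larger interval starting there, which
    determines them by induction on the size of the interval. *)
Lemma mobius_wbond (p : wbond e) : mobius (wbond0 e) p = block_product p.
Proof.
have lf := @finite_wbond_itv T e.
have [n] := ubnP #|` fset_set (poset_itv (wbond0 e) p)|.
elim: n p => // n IH p; rewrite ltnS => pn.
have [->|np] := eqVneq p (wbond0 e); first by rewrite mobiusxx block_product0.
have lt0 : (wbond0 e < p)%O by rewrite lt_neqAle eq_sym np wbond0_le.
have pin : poset_itv (wbond0 e) p p by rewrite /poset_itv /= wbond0_le lexx.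
have := mobius_sum lf lt0; have := block_product_sum np.
rewrite (fsbigD1 p _ (fun z : wbond e => block_product z)) //=.
rewrite (fsbigD1 p _ (mobius (wbond0 e))) //=.
rewrite [X in _ -> _ + X = _ -> _](eq_fsbigr (fun z : wbond e => block_product z)).
  by move=> E1 E2; apply: (addIr (_ : int)); apply: etrans E2 (esym E1).
move=> z; rewrite inE /poset_itv /= => -[/andP[_ zp] /eqP nzp].
apply: IH; apply: leq_trans pn; apply: card_itv_lt => //.
by rewrite wbond0_le lt_neqAle nzp.
Qed.

(** This is [inner_sum] for the whole vertex set, where nothing is left outside, with the total
    weight fixed to [nu]. *)
Lemma PsiE nu : Psi e nu =
  scoef nu (\sum_(P | finset.partition P [set: T]%SET) \prod_(B in P) psi B).
Proof.
rewrite /Psi (eq_fsbigr (fun p : wbond e => block_product p)); last first.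
  by move=> p _; apply: mobius_wbond.
have fin := finite_wbond_weight e nu.
rewrite fsbig_finite //.
transitivity (\sum_(z <- fset_set [set p : wbond e | weight p = nu]%classic)
    \prod_(B in inner_blocks [set: T]%SET z) scoef (wt z B) (psi B)).
  apply: eq_bigr => z _; apply: eq_bigl => B.
  by rewrite inE finset.subsetT andbT.
rewrite (@inner_sum [set: T]%SET (wbond0 e) nu (pred1 nu)).
- rewrite raddf_sum /=; apply: eq_bigr => P _.
  rewrite big_mkcond (big_fsetD1 nu) /=; last exact/lowerP/wcomp_le_refl.
  rewrite eqxx big1_fset ?addr0 // => mu.
  by rewrite in_fsetD1 => /andP[/negbTE-> _].
- by move=> B _; left; apply: finset.subsetT.
- by move=> m /eqP ->.
- move=> z; rewrite in_fset_set // inE /=.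
  have -> : inner_weight [set: T]%SET z = weight z.
    by apply: eq_bigl => B; rewrite finset.subsetT andbT.
  split=> [->|[_ /eqP//]]; split=> //.
  congr pair; first by apply/setP => B; rewrite !inE finset.subsetT !andbF.
  by apply/ffunP => B; rewrite !ffunE finset.subsetT.
Qed.

End MobiusFormula.

Theorem theorem7p2 (T : finType) (e : rel T) :
  symmetric e -> irreflexive e -> chordal e ->
  forall d : nat,
    e_positive (fun nu : wcomp => (-1) ^+ d * homog d (Psi e) nu).
Proof.
move=> e_sym e_irr e_chordal d.
have [phi phiP phi_pos] := chordal_block_series e_sym e_irr e_chordal.
pose s (P : {set {set T}}) := (\sum_(B in P) #|B|.-1)%N.
(* The product over [P] is homogeneous of degree [s P], so the component of degree [d] collects the
   partitions with [s P = d]. *)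
rewrite (_ : (fun nu => _) =
  (\sum_(P | finset.partition P [set: T]%SET && (s P == d)) \prod_(B in P) phi B : ser)).
  apply: (@e_pos_e_positive d); apply: e_pos_sum => P /andP[_ /eqP<-].
  by apply: e_pos_prod => B _; apply: phi_pos.
apply: (@serP (fun nu => (-1) ^+ d * homog d (Psi e) nu)) => nu.
rewrite [LHS]/scoef /homog (PsiE phiP) [X in _ = scoef nu X]big_mkcondr !raddf_sum /=.
have hom P : homogeneous (s P) (\prod_(B in P) phi B).
  by apply: homogeneous_prod => B _; apply: block_homogeneous phiP B.
case: (eqVneq (mdeg nu) d) => [dnu|dnu]; last first.
  rewrite mulr0 big1 // => P _; case: (eqVneq (s P) d) => [sP|_]; last by rewrite raddf0.
  by rewrite hom // sP.
rewrite mulr_sumr; apply: eq_bigr => P _.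
rewrite /signed_block big_split /= -expr_sum -/(s P) scoef_sign.
(* The signs of the blocks multiply to (-1)^(s P), which cancels (-1)^d. *)
case: (eqVneq (s P) d) => [->|sP]; first by rewrite mulrA -expr2 sqrr_sign mul1r.
by rewrite hom ?mulr0 ?raddf0 // dnu eq_sym.
Qed.
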